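(* Let $T$ be a linearly recurrent interval exchange transformation on $[0,1[$, let $N\ge2$, and let $T_f(x,s)=(Tx,s+f(x))$ on $[0,1[\times\mathbb{Z}/N\mathbb{Z}$ be the Veech 1969 type extension of $T$ by a step function $f$ with two marked points $0<\zeta_1<\zeta_2<1$ and values $a_1,a_2,a_3\in\mathbb{Z}$. Assume that $T_f$ is fully ramified and that $T_f$ is minimal. Then $T_f$ is uniquely ergodic.
   Context: Interval exchange: given $\lambda_1,\dots,\lambda_r>0$ with sum $1$ and a permutation $\pi$ of $\{1,\dots,r\}$, put $I_i=[\sum_{j<i}\lambda_j,\sum_{j\le i}\lambda_j[$ (semi-open) and $Tx=x+\sum_{\pi^{-1}(j)<\pi^{-1}(i)}\lambda_j-\sum_{j<i}\lambda_j$ for $x\in I_i$; the images are, from left to right, $TI_{\pi(1)},\dots,TI_{\pi(r)}$. Linear recurrence: the trajectory of $x$ is $(x_n)_{n\ge0}$ with $x_n=i$ if $T^nx\in I_i$; $L(T)$ is the set of all finite factors of all trajectories. $T$ is linearly recurrent if there is a constant $K$ such that each word of length $n$ of $L(T)$ occurs in every word of length at least $Kn$ of $L(T)$. Step function: $f$ maps $[0,1[$ to $\mathbb{Z}/N\mathbb{Z}$, with $f=a_1$ on $[0,\zeta_1[$, $f=a_2$ on $[\zeta_1,\zeta_2[$, $f=a_3$ on $[\zeta_2,1[$ (reduced modulo $N$). Geometric model: let $X$ be the translation surface given by Masur's polygon over $T$: the polygon with upper boundary the consecutive vectors $v_1,\dots,v_r$ and lower boundary the consecutive vectors $v_{\pi(1)},\dots,v_{\pi(r)}$,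 both starting from the origin, where $v_i=(\lambda_i,\tau_i)$ with $\sum_{j\le k}\tau_j>0$ and $\sum_{j\le k}\tau_{\pi(j)}<0$ for $1\le k\le r-1$ and $\sum_{j\le r}\tau_j=0$ (e.g. $\tau_i=\pi^{-1}(i)-i$), the upper and lower sides equal to $v_i$ being glued by translation. The first return map of the vertical flow on the horizontal segment $[0,1]\times\{0\}$ is $T$. Let $O,P,Q,\Omega$ be the points of $X$ on this horizontal segment with abscissas $0,\zeta_1,\zeta_2,1$ ($O$ and $\Omega$ may be the same point of $X$). Make slits $V_1$ from $O$ to $P$, $V_2$ from $P$ to $Q$, $V_3$ from $Q$ to $\Omega$ in each of $N$ copies of $X$ (indexed by $\mathbb{Z}/N\mathbb{Z}$), and glue the top side of $V_i$ in copy $k$ with the bottom side of $V_i$ in copy $k+a_i$. This gives a surface $Y$ and a covering $\Pi:Y\to X$, ramified over (at most) $O,P,Q,\Omega$. $T_f$ is fully ramified if the ramification index of $\Pi$ at each of the points $O,P,Q,\Omega$ is equal to $N$, i.e. each of these points has exactly one preimage by $\Pi$ in $Y$. Minimal: every orbit is dense ($[0,1[\times\{s\}$ has the usual interval topology). Uniquely ergodic: there exists a unique invariant probability measure. *)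

(* Defs.v *)
From HB Require Import structures.
From Stdlib Require Import Relation_Operators.
From mathcomp Require Import all_boot all_order all_fingroup all_algebra.
From mathcomp Require Import all_classical all_reals all_analysis.
From mathcomp Require Import ring.

Set Implicit Arguments.
Unset Strict Implicit.
Unset Printing Implicit Defensive.

Import Order.TTheory GRing.Theory Num.Theory.
Import numFieldNormedType.Exports.

Local Open Scope classical_set_scope.
Local Open Scope ring_scope.

(** * Interval exchange transformations *)

Section IntervalExchange.
Context {R : realType} {r : nat}.
Implicit Types (v lam : 'I_r -> R) (p : 'S_r).

(* Indices run over {0, .., r-1}; position k (from the left) of the image
   partition is occupied by the interval p k, so p^-1 j is the position of
   the image of the interval j. *)
Definition upper_start v (i : 'I_r) : R := \sum_(j < r | (j < i)%N) v j.
Definition lower_start p v (i : 'I_r) : R :=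
  \sum_(j < r | ((p^-1)%g j < (p^-1)%g i)%N) v j.

Definition iet_lengths lam : Prop :=
  (forall i, 0 < lam i) /\ \sum_i lam i = 1.

Definition iet_interval lam (i : 'I_r) : interval R :=
  `[upper_start lam i, \sum_(j < r | (j <= i)%N) lam j[.

(* Extended by the identity outside [0, 1[. *)
Definition iet lam p (x : R) : R :=
  if [pick i | x \in iet_interval lam i] is Some i
  then x + lower_start p lam i - upper_start lam i
  else x.

Definition trajectory lam p (x : R) (n : nat) : option 'I_r :=
  [pick i | iter n (iet lam p) x \in iet_interval lam i].

Definition iet_language lam p : set (seq 'I_r) :=
  [set w | exists2 x, x \in `[0, 1[ & exists m,
    [seq Some i | i <- w] = [seq trajectory lam p x k | k <- iota m (size w)]].

Definition linearly_recurrent lam p : Prop :=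
  exists K : nat, forall u w,
    iet_language lam p u -> iet_language lam p w ->
    (K * size u <= size w)%N -> infix u w.

End IntervalExchange.

(** * The extension by a step function *)

Definition step_fun {R : realType} (N : nat) (z1 z2 : R) (a1 a2 a3 : int)
    (x : R) : 'Z_N :=
  (if x < z1 then a1 else if x < z2 then a2 else a3)%:~R.

(* Z/N with the discrete topology and the discrete sigma-algebra. *)
Definition cyc (N : nat) : Type := 'Z_N.

HB.instance Definition _ N := Finite.on (cyc N).
HB.instance Definition _ N := isPointed.Build (cyc N) (0 : 'Z_N).
HB.instance Definition _ N :=
  Topological.copy (cyc N) (discrete_topology 'Z_N).
HB.instance Definition _ N :=
  @isMeasurable.Build default_measure_display (cyc N)
    discrete_measurable discrete_measurable0
    discrete_measurableC discrete_measurableU.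

Section Extension.
Context {R : realType} {N : nat}.
Implicit Type F : R * cyc N -> R * cyc N.

(* The phase space [0, 1[ x Z/N, as a Borel subset of R x Z/N. *)
Definition phase_space : set (R * cyc N) := [set` `[0, 1[%R] `*` setT.

Definition veech_ext {r : nat} (lam : 'I_r -> R) (p : 'S_r) (z1 z2 : R)
    (a1 a2 a3 : int) (z : R * cyc N) : R * cyc N :=
  (iet lam p z.1, (z.2 : 'Z_N) + step_fun N z1 z2 a1 a2 a3 z.1).

(* Two-sided orbits: the maps considered here are bijections. *)
Definition orbit F (z : R * cyc N) : set (R * cyc N) :=
  [set w | exists n, w = iter n F z \/ z = iter n F w].

Definition minimal F : Prop :=
  forall z, phase_space z -> phase_space `<=` closure (orbit F z).

(* Probability measures on the phase space are the probability measures on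
   R x Z/N giving it full mass. *)
Definition invariant_probability F (mu : probability (R * cyc N)%type R) :=
  mu phase_space = 1%E /\
  forall A, measurable A -> mu (F @^-1` A) = mu A.

(* A measure is only determined by its values on measurable sets. *)
Definition uniquely_ergodic F : Prop :=
  exists2 mu, invariant_probability F mu &
    forall nu, invariant_probability F nu ->
      forall A, measurable A -> nu A = mu A.

End Extension.

(** * Gluings *)

Section Gluing.
Context {T : choiceType} (g : T -> T -> Prop).

Definition glued : rel T := fun x y => `[< clos_refl_sym_trans T g x y >].

Lemma glued_refl : reflexive glued.
Proof. by move=> x; apply/asboolP; exact: rst_refl. Qed.

Lemma glued_sym : symmetric glued.
Proof. by move=> x y; apply/asboolP/asboolP; exact: rst_sym. Qed.

Lemma glued_trans : transitive glued.
Proof.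
by move=> y x z /asboolP xy /asboolP yz; apply/asboolP; exact: rst_trans yz.
Qed.

Canonical glued_equiv := EquivRel glued glued_refl glued_sym glued_trans.

Definition gluing := {eq_quot glued_equiv}%qT.

Definition to_gluing (x : T) : gluing := \pi_gluing%qT x.
Definition of_gluing (y : gluing) : T := generic_quotient.repr y.

Lemma to_gluingP x y :
  reflect (clos_refl_sym_trans T g x y) (to_gluing x == to_gluing y).
Proof. by rewrite piE; exact: asboolP. Qed.

Lemma of_gluingK : cancel of_gluing to_gluing.
Proof. exact: reprK. Qed.

End Gluing.

(** * The translation surface of an interval exchange *)

Section Surfaces.
Context {R : realType} {r : nat}.
Variables (lam : 'I_r -> R) (p : 'S_r) (tau : 'I_r -> R).

Definition suspension_data : Prop :=
  [/\ forall k, (0 < k < r)%N -> 0 < \sum_(j < r | (j < k)%N) tau j,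
      forall k, (0 < k < r)%N -> \sum_(j < r | (j < k)%N) tau (p j) < 0
    & \sum_j tau j = 0].

(* The points of parameter t in [0, 1] on the upper and lower sides v_i. *)
Definition upper_side (i : 'I_r) (t : R) : R * R :=
  (upper_start lam i + t * lam i, upper_start tau i + t * tau i).
Definition lower_side (i : 'I_r) (t : R) : R * R :=
  (lower_start p lam i + t * lam i, lower_start p tau i + t * tau i).

Definition polygon : set (R * R) :=
  [set q | exists i j s t, [/\ 0 <= s <= 1, 0 <= t <= 1,
     (upper_side i s).1 = q.1, (lower_side j t).1 = q.1
     & (lower_side j t).2 <= q.2 <= (upper_side i s).2]].

Definition side_glue (q q' : R * R) : Prop :=
  exists i t, [/\ 0 <= t <= 1, q = upper_side i t & q' = lower_side i t].

(* The points of X. *)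
Definition surface : Type :=
  gluing (fun q q' : polygon => side_glue (val q) (val q')).

Section Covering.
Variables (N : nat) (z1 z2 : R) (a1 a2 a3 : int).

(* Together the three slits cut the polygon along its whole horizontal
   diagonal [0, 1] x {0}. A point (q, b, k) lies in copy k of the cut polygon,
   in its closed upper (b = true) or lower (b = false) half; points of the
   diagonal thus come twice, (q, true, k) being on the top side of the slit
   and (q, false, k) on its bottom side. The ends of the slits are doubled as
   well (as in the completion of the slit surface), then identified only as
   the closed sides of the polygon and of the slits are glued. *)
Definition cut_polygons : set (polygon * bool * 'Z_N) :=
  [set c | let y := (val c.1.1).2 in if c.1.2 then 0 <= y else y <= 0].

(* (x, 0) lies on the (closed) slit V_i and k' = k + a_i, for some i. *)
Definition slit_glue (x : R) (k k' : 'Z_N) : Prop :=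
  [\/ 0 <= x <= z1 /\ k' = k + a1%:~R,
      z1 <= x <= z2 /\ k' = k + a2%:~R
    | z2 <= x <= 1 /\ k' = k + a3%:~R].

Definition covering_glue (c c' : cut_polygons) : Prop :=
  let: (q, b, k) := val c in
  let: (q', b', k') := val c' in
  [/\ b = true, b' = false
    & (side_glue (val q) (val q') /\ k = k') \/
      [/\ q = q', (val q).2 = 0 & slit_glue (val q).1 k k']].

(* The points of Y. *)
Definition covering_surface : Type := gluing covering_glue.

Definition cut_proj (c : cut_polygons) : polygon := (val c).1.1.

(* The map Pi. *)
Definition covering (y : covering_surface) : surface :=
  to_gluing _ (cut_proj (of_gluing y)).

Lemma covering_pi (c : cut_polygons) :
  covering (to_gluing _ c) = to_gluing _ (cut_proj c).
Proof.
have glueP c1 c2 : clos_refl_sym_trans _ covering_glue c1 c2 ->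
    to_gluing (fun q q' : polygon => side_glue (val q) (val q')) (cut_proj c1) =
    to_gluing _ (cut_proj c2).
  elim=> {c1 c2} [c1 c2|//|c1 c2 _ -> //|c1 c2 c3 _ -> _ -> //].
  rewrite /covering_glue /cut_proj.
  case: (val c1) (val c2) => [[q b] k] [[q' b'] k'] /= [_ _ [[h _]|[-> //]]].
  by apply/eqP/to_gluingP; exact: rst_step.
by apply: glueP; apply/to_gluingP; rewrite of_gluingK.
Qed.

(* Ramification index N at each of O, P, Q, Omega: a single preimage. The
   points (x, 0) do belong to the polygon, by base_in_polygon below. *)
Definition fully_ramified : Prop :=
  forall x, x \in [:: 0; z1; z2; 1] ->
  forall q : polygon, val q = (x, 0) ->
  exists! y : covering_surface, covering y = to_gluing _ q.

End Covering.

Lemma prefix_cover (l : 'I_r -> R) x :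
    (forall i, 0 < l i) -> \sum_i l i = 1 -> 0 <= x <= 1 ->
  exists k t, 0 <= t <= 1 /\ upper_start l k + t * l k = x.
Proof.
move=> l0 l1 /andP[x0 x1].
pose S k := \sum_(j < r | (j < k)%N) l j.
have S0 : S 0%N = 0 by rewrite /S big1.
have Sr : S r = 1 by rewrite -l1; apply: eq_bigl => j; rewrite ltn_ord.
have r0 : (0 < r)%N.
  case: (posnP r) => // r0; suff : (1 : R) = 0 by move/eqP; rewrite oner_eq0.
  by rewrite -l1 big1// => i; have := ltn_ord i; rewrite {2}r0.
have SS (k : 'I_r) : S k.+1 = S k + l k.
  rewrite /S (bigD1 k) ?ltnSn//= addrC; congr (_ + _).
  by apply: eq_bigl => j; rewrite ltnS ltn_neqAle andbC.
have [k Sk Sk1] : exists2 k : 'I_r, S k <= x & x <= S k.+1.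
  have ex : exists n, (n < r)%N && (S n <= x) by exists 0%N; rewrite r0 S0.
  have ub n : (n < r)%N && (S n <= x) -> (n <= r)%N by case/andP => /ltnW.
  case: (ex_maxnP ex ub) => n /andP[nr Sn] max.
  exists (Ordinal nr) => //=.
  have [nr1|] := ltnP n.+1 r.
    rewrite leNgt; apply/negP => /ltW Sx.
    by have := max n.+1; rewrite nr1 Sx ltnn => /(_ isT).
  move=> rn; have -> : n.+1 = r by apply/eqP; rewrite eqn_leq nr.
  by rewrite Sr.
have lk := l0 k.
exists k, ((x - S k) / l k); split; last first.
  by rewrite divfK ?gt_eqF// addrC subrK.
apply/andP; split; first by rewrite divr_ge0 ?subr_ge0// ltW.
by rewrite ler_pdivrMr// mul1r lerBlDl -SS.
Qed.

Lemma lower_start_perm (v : 'I_r -> R) k :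
  lower_start p v (p k) = upper_start (v \o p) k.
Proof.
rewrite /lower_start (reindex_inj (@perm_inj _ p))/=.
by apply: eq_bigl => j; rewrite !permK.
Qed.

Lemma prefix_convex (v : 'I_r -> R) k t : 0 <= t <= 1 ->
    (forall n, (0 < n < r)%N -> 0 <= \sum_(j < r | (j < n)%N) v j) ->
    \sum_j v j = 0 ->
  0 <= upper_start v k + t * v k.
Proof.
move=> /andP[t0 t1] vn v0.
have vn' n : (n <= r)%N -> 0 <= \sum_(j < r | (j < n)%N) v j.
  case: (posnP n) => [->|n0]; first by rewrite big1.
  rewrite leq_eqVlt => /orP[/eqP ->|nr]; last by apply: vn; rewrite n0.
  by rewrite (eq_bigl xpredT) ?v0// => j; rewrite ltn_ord.
have h0 := vn' k (ltnW (ltn_ord k)).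
have : 0 <= upper_start v k + v k.
  have := vn' k.+1 (ltn_ord k); congr (_ <= _).
  rewrite /upper_start (bigD1 k) ?ltnSn//= addrC; congr (_ + _).
  by apply: eq_bigl => j; rewrite ltnS ltn_neqAle andbC.
rewrite -/(upper_start v k) in h0 => h1.
have -> : upper_start v k + t * v k =
    (1 - t) * upper_start v k + t * (upper_start v k + v k) by ring.
by rewrite addr_ge0// mulr_ge0// subr_ge0.
Qed.

Lemma base_in_polygon x : iet_lengths lam -> suspension_data ->
  0 <= x <= 1 -> polygon (x, 0).
Proof.
move=> [l0 l1] [tu tl t0] x01.
have [i [s [s01 xi]]] := prefix_cover l0 l1 x01.
have l1' : \sum_i (lam \o p) i = 1.
  by rewrite -l1 [RHS](reindex_inj (@perm_inj _ p)).
have [k [t [t01 xk]]] := prefix_cover (fun i => l0 (p i)) l1' x01.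
exists i, (p k), s, t; split => //=; first by rewrite lower_start_perm.
apply/andP; split; last by apply: prefix_convex => // n /tu /ltW.
rewrite lower_start_perm -oppr_ge0 opprD -mulrN.
have -> : - upper_start (tau \o p) k = upper_start (fun i => - tau (p i)) k.
  by rewrite /upper_start sumrN.
apply: (prefix_convex (v := fun i => - tau (p i))) => // [n /tl|].
  by rewrite sumrN oppr_ge0 => /ltW.
by move: t0; rewrite (reindex_inj (@perm_inj _ p))/= sumrN => ->; rewrite oppr0.
Qed.

End Surfaces.

(* Main.v *)
From HB Require Import structures.
Require Import Defs.
From mathcomp Require Import all_boot all_order all_fingroup all_algebra.
From mathcomp Require Import all_classical all_reals all_analysis.
From mathcomp Require Import measurable_realfun.
From mathcomp Require Import ring lra zify.

(** Linear recurrence with constant [K] makes the exchange [T] tame at every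
    scale. An [n]-cylinder, the set of points with a given coding up to time
    [n - 1], is an interval which [T^k] translates rigidly for [k <= n]; every
    orbit enters it within time [K * n], and none returns to it before a time
    of order [n / K] ([no_early_return]). So every invariant probability gives
    it a mass between [1 / (K * n)] and [2 * K / n], a point stays at distance
    at least [1 / (2 * K ^ 2 * n)] from its first [n] iterates ([return_dist]),
    and comparing a cylinder of nearly extremal density with all others shows
    that length is the only invariant probability of [T] ([mass_eq_length]).

    Let [nu] be an invariant probability of the extension. It projects to the
    length, so it is described by the vectors of masses over the fibres [avg u
    v = (nu ([u, v[ x {s}) / (v - u))_s], whose entries are nonnegative with
    sum 1. Among the limits of such vectors choose [m] of maximal Euclidean
    norm ([maximal_vector]). If [m] has the norm of the uniform vector, all the
    [avg u v] are uniform and [nu] is the product of the length by the uniform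
    measure. Otherwise the periods of [m] form a proper subgroup [H] of [Z/N],
    and this is what has to be contradicted.

    By extremality, at every small scale there are cylinders [J], called good,
    over which the average is so close to [m] that the average over each
    subsegment of length at least [theta * |J|] is close to [m] too. If such a
    segment is carried rigidly from [J] to [J], with [f] constant on it at each
    step, the sum of [f] along the way translates one vector close to [m] to
    another one, hence lies in [H] ([good_returns_period]). So the sum of [f]
    over a first return to [J] is in [H] on each long segment where it is
    constant. Since [f] jumps at [z1] and [z2] only, this return cocycle jumps,
    inside the cylinders of order [(K + 1) * n] (on which the return time is
    constant), only at the two points [P1], [P2] of [J] from which [z1], [z2]
    are reached before the return ([entry], [ret_sum_const]).

    - Suppose that [P1] is an end of its cylinder of order [(K + 1) * n], or is
      not close to its ends. Then the cocycle takes its values in [H] outside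
      at most one short segment starting or ending at [P2] ([bad_segment]). If
      there is no bad segment, [f] is a coboundary modulo [H], and the graph of
      its transfer function contradicts minimality ([no_trivial_return]). If
      there is a bad segment of length [d], take a good cylinder [J'] in [J] at
      an order comparable to [1 / d]: the points of a return path to [J'] are
      more than [d] apart, so they visit the bad segment at most once, and for
      a segment of [J'] of length comparable to [|J'|] they visit it exactly
      once. There the return cocycle of [J'] is not in [H], although [J'] is
      good ([isolated_bad_segment]).
    - Suppose that [P1] is at a small positive distance [d] from an end. At an
      order comparable to [1 / d], the entry point of a good cylinder [J'] in
      [J] travels to [P1] before it returns. The end at distance [d] from [P1]
      pulls back to an end of a cylinder at the new scale, where all cylinders
      are longer than [d]; this leaves no room for an end close to the new
      entry point, and the first case applies ([left_anchor], [right_anchor],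
      [no_good_cylinder]). *)

Set Implicit Arguments.
Unset Strict Implicit.
Unset Printing Implicit Defensive.

Import Order.TTheory GRing.Theory Num.Theory.
Import numFieldNormedType.Exports.

Local Open Scope ring_scope.

(** * Exchanged intervals *)

Section Partition.
Context {R : realType} {r : nat}.
Implicit Types (v lam : 'I_r -> R) (x : R).

Lemma upper_startS v (i : 'I_r) :
  \sum_(j < r | (j <= i)%N) v j = upper_start v i + v i.
Proof.
rewrite /upper_start (bigD1 i) ?leqnn//= addrC; congr (_ + _).
by apply: eq_bigl => j; rewrite ltn_neqAle andbC.
Qed.

Lemma iet_intervalE v (i : 'I_r) x :
  (x \in iet_interval v i) = (upper_start v i <= x < upper_start v i + v i).
Proof. by rewrite /iet_interval in_itv/= upper_startS. Qed.

Lemma upper_start_bounds v (i : 'I_r) : iet_lengths v ->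
  0 <= upper_start v i /\ upper_start v i + v i <= 1.
Proof.
move=> [v0 v1]; split; first by apply: sumr_ge0 => j _; exact/ltW.
rewrite -upper_startS -v1 [leRHS](bigID (fun j : 'I_r => (j <= i)%N))/= lerDl.
by apply: sumr_ge0 => j _; exact/ltW.
Qed.

Lemma upper_start_le v (i j : 'I_r) : iet_lengths v -> (i < j)%N ->
  upper_start v i + v i <= upper_start v j.
Proof.
move=> [v0 _] ij; rewrite -upper_startS /upper_start.
rewrite [leRHS](bigID (fun k : 'I_r => (k <= i)%N))/=.
rewrite (eq_bigl (fun k : 'I_r => (k < j)%N && (k <= i)%N)); last first.
  by move=> k; case: (leqP k i) => //= ki; rewrite ?andbF ?andbT ?(leq_ltn_trans ki).
by rewrite lerDl; apply: sumr_ge0 => k _; exact/ltW.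
Qed.

Lemma iet_interval_inj v (i j : 'I_r) x : iet_lengths v ->
  x \in iet_interval v i -> x \in iet_interval v j -> i = j.
Proof.
move=> hv; rewrite !iet_intervalE => /andP[ix xi] /andP[jx xj].
apply/val_inj; case: (ssrnat.ltngtP i j) => // h.
- by exfalso; have := upper_start_le hv h; lra.
- by exfalso; have := upper_start_le hv h; lra.
Qed.

(** The interval containing [x] is the last one that starts at or before [x].
    *)
Lemma iet_interval_cover v x : iet_lengths v -> 0 <= x < 1 ->
  exists i, x \in iet_interval v i.
Proof.
move=> hv /andP[x0 x1].
have r0 : (0 < r)%N.
  case: (posnP r) => // r0; suff : (1 : R) = 0 by move/eqP; rewrite oner_eq0.
  by case: hv => _ <-; rewrite big1// => i; have := ltn_ord i; rewrite {2}r0.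
pose S k := \sum_(j < r | (j < k)%N) v j.
have S0 : S 0%N = 0 by rewrite /S big1.
have Sr : S r = 1 by case: hv => _ <-; apply: eq_bigl => j; rewrite ltn_ord.
have ex : exists n, (n < r)%N && (S n <= x) by exists 0%N; rewrite r0 S0.
have ub n : (n < r)%N && (S n <= x) -> (n <= r)%N by case/andP => /ltnW.
case: (ex_maxnP ex ub) => n /andP[nr Sn] max.
exists (Ordinal nr); rewrite iet_intervalE -upper_startS.
apply/andP; split => //.
rewrite (_ : \sum_(j < r | _) _ = S n.+1)//.
have [nr1|rn] := ltnP n.+1 r.
  rewrite ltNge; apply/negP => Sx.
  by have := max n.+1; rewrite nr1 Sx ltnn => /(_ isT).
have -> : n.+1 = r by apply/eqP; rewrite eqn_leq nr.
by rewrite Sr.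
Qed.

End Partition.

(** * Cylinders *)

Section Dynamics.
Context {R : realType} {r : nat}.
Variables (lam : 'I_r -> R) (p : 'S_r).
Hypothesis hlam : iet_lengths lam.
Implicit Types (x y z : R) (n m k : nat) (i : 'I_r).

Local Notation T := (iet lam p).
Local Notation "T^( n ) x" := (iter n T x) (at level 10, x at next level).

Definition piece (x : R) : option 'I_r := [pick i | x \in iet_interval lam i].

Lemma piece_some x i : x \in iet_interval lam i -> piece x = Some i.
Proof.
rewrite /piece => xi; case: pickP => [j xj|/(_ i)]; last by rewrite xi.
by rewrite (iet_interval_inj hlam xi xj).
Qed.

Lemma pieceP x : 0 <= x < 1 ->
  exists2 i, piece x = Some i & upper_start lam i <= x < upper_start lam i + lam i.
Proof.
move=> /(iet_interval_cover hlam)[i xi]; exists i; first exact: piece_some.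
by rewrite -iet_intervalE.
Qed.

Lemma piece_in x i : piece x = Some i ->
  upper_start lam i <= x < upper_start lam i + lam i.
Proof.
by rewrite /piece; case: pickP => // j xj [<-]; rewrite -iet_intervalE.
Qed.

Lemma iet_piece x i : piece x = Some i ->
  T x = x + (lower_start p lam i - upper_start lam i).
Proof. by rewrite /piece /iet => ->; rewrite addrA. Qed.

Lemma piece_outside x : ~~ (0 <= x < 1) -> piece x = None.
Proof.
move=> xX; case E : (piece x) => [i|//]; exfalso; have := piece_in E.
by have := upper_start_bounds i hlam; move: xX; lra.
Qed.

Lemma iet_outside x : ~~ (0 <= x < 1) -> T x = x.
Proof. by move/piece_outside; rewrite /piece /iet => ->. Qed.

Lemma permuted_lengths : iet_lengths (lam \o p).
Proof.
case: hlam => l0 l1; split => [i|]; first exact: l0.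
by rewrite -l1 [RHS](reindex_inj (@perm_inj _ p)).
Qed.

(** The images of the exchanged intervals are the intervals of the permuted
    lengths, in the position [p^-1 i]: injectivity and surjectivity of the
    exchange are those of this second partition. *)
Lemma iet_image x i : piece x = Some i ->
  T x \in iet_interval (lam \o p) (p^-1%g i).
Proof.
move=> xi; rewrite iet_intervalE (iet_piece xi).
have := piece_in xi; rewrite -(lower_start_perm p lam) /= permKV; lra.
Qed.

Lemma iet_in x : 0 <= x < 1 -> 0 <= T x < 1.
Proof.
move=> /pieceP[i /iet_image]; rewrite iet_intervalE => + _.
have := upper_start_bounds (p^-1%g i) permuted_lengths; lra.
Qed.

Lemma iter_iet_in n x : 0 <= x < 1 -> 0 <= T^(n) x < 1.
Proof. by move=> xX; elim: n => //= n /iet_in. Qed.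

Lemma iet_inj x y : 0 <= x < 1 -> 0 <= y < 1 -> T x = T y -> x = y.
Proof.
move=> /pieceP[i xi _] /pieceP[j yj _] Txy.
have := iet_image xi; rewrite Txy => xi'.
have /(@perm_inj _ (p^-1)%g) ij := iet_interval_inj permuted_lengths xi' (iet_image yj).
by move: Txy; rewrite (iet_piece xi) (iet_piece yj) ij; lra.
Qed.

Lemma iter_iet_inj n x y : 0 <= x < 1 -> 0 <= y < 1 -> T^(n) x = T^(n) y -> x = y.
Proof.
move=> xX yX; elim: n => //= n IH /iet_inj; rewrite !iter_iet_in// => /(_ isT isT).
exact: IH.
Qed.

Lemma iet_surj y : 0 <= y < 1 -> exists2 x, 0 <= x < 1 & T x = y.
Proof.
move=> /(iet_interval_cover permuted_lengths)[k].
rewrite iet_intervalE -(lower_start_perm p lam) /= => yk.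
pose x := y - lower_start p lam (p k) + upper_start lam (p k).
have xk : piece x = Some (p k).
  by apply: piece_some; rewrite iet_intervalE /x; lra.
exists x; last by rewrite (iet_piece xk) /x; lra.
by have := piece_in xk; have := upper_start_bounds (p k) hlam; lra.
Qed.

Lemma iter_iet_surj n y : 0 <= y < 1 -> exists2 x, 0 <= x < 1 & T^(n) x = y.
Proof.
elim: n y => [|n IH] y yX; first by exists y.
have [z zX <-] := iet_surj yX; have [x xX <-] := IH z zX.
by exists x.
Qed.

(** [x] and [y] lie in the same [n]-cylinder. *)
Definition agree (n : nat) (x y : R) : Prop :=
  forall k, (k < n)%N -> piece (T^(k) x) = piece (T^(k) y).

Lemma agree_refl n x : agree n x x. Proof. by []. Qed.

Lemma agree_sym n x y : agree n x y -> agree n y x.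
Proof. by move=> h k /h. Qed.

Lemma agree_trans n x y z : agree n x y -> agree n y z -> agree n x z.
Proof. by move=> h h' k kn; rewrite h ?h'. Qed.

Lemma agree_le n m x y : (m <= n)%N -> agree n x y -> agree m x y.
Proof. by move=> mn h k km; apply: h; exact: leq_trans mn. Qed.

Lemma agree_shift n m k x y : (k + m <= n)%N -> agree n x y ->
  agree m (T^(k) x) (T^(k) y).
Proof. by move=> kmn h i im; rewrite -!iterD; apply: h; lia. Qed.

Lemma agree_iter n k x y : 0 <= x < 1 -> agree n x y -> (k <= n)%N ->
  T^(k) y = T^(k) x + (y - x).
Proof.
move=> xX h; elim: k => [|k IH] kn /=; first by rewrite addrC subrK.
have := pieceP (iter_iet_in k xX) => -[i xi _].
have yi := xi; rewrite (h k kn) in yi.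
by rewrite (iet_piece xi) (iet_piece yi) (IH (ltnW kn)); lra.
Qed.

Definition piece_start (y : R) : R :=
  if piece y is Some i then upper_start lam i else 0.
Definition piece_end (y : R) : R :=
  if piece y is Some i then upper_start lam i + lam i else 0.

(** The ends of the [n]-cylinder of [x], obtained by pulling back to [x] the
    constraints met along its orbit. Two points of one cylinder have equal ends
    ([cyl_agree]), so that a cylinder can be named by any of its points. *)
Fixpoint cyl_lo n x : R := if n is m.+1
  then Num.max (cyl_lo m x) (piece_start (T^(m) x) + (x - T^(m) x)) else 0.
Fixpoint cyl_hi n x : R := if n is m.+1
  then Num.min (cyl_hi m x) (piece_end (T^(m) x) + (x - T^(m) x)) else 1.
Definition cyl_len n x := cyl_hi n x - cyl_lo n x.

Lemma piece_eqE x y : 0 <= x < 1 ->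
  piece y = piece x <-> piece_start x <= y < piece_end x.
Proof.
move=> /pieceP[i xi _]; rewrite /piece_start /piece_end xi; split.
  exact: piece_in.
by move=> h; apply: piece_some; rewrite iet_intervalE.
Qed.

(** As long as the codings agree, [T^k] translates both points by the same
    amount, so each further letter cuts the current interval by an interval. *)
Lemma cylE n x y : 0 <= x < 1 ->
  cyl_lo n x <= y < cyl_hi n x <-> 0 <= y < 1 /\ agree n x y.
Proof.
move=> xX; elim: n => [|n [IH1 IH2]] /=; first by split=> [h|[]//]; split=> // k.
have e := piece_eqE _ (iter_iet_in n xX).
split.
  rewrite ge_max lt_min => h.
  have [|yX h1] := IH1; first lra.
  split=> // k; rewrite ltnS leq_eqVlt => /orP[/eqP->|]; last exact: h1.
  apply/esym/e; rewrite (agree_iter xX h1 (leqnn _)); lra.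
move=> [yX h]; have h1 := agree_le (leqnSn n) h.
have := proj1 (e _) (esym (h n (ltnSn n))).
rewrite (agree_iter xX h1 (leqnn _)) ge_max lt_min.
have := IH2 (conj yX h1); lra.
Qed.

Lemma cyl_bounds n x : 0 <= x < 1 ->
  [/\ 0 <= cyl_lo n x, cyl_lo n x <= x, x < cyl_hi n x & cyl_hi n x <= 1].
Proof.
move=> xX; have /andP[l h] := proj2 (cylE n x xX) (conj xX (@agree_refl n x)).
split => //; elim: n {l h} => //= n IH.
  by rewrite le_max IH.
by rewrite ge_min IH.
Qed.

Lemma cyl_agree n x y : 0 <= x < 1 -> 0 <= y < 1 -> agree n x y ->
  cyl_lo n y = cyl_lo n x /\ cyl_hi n y = cyl_hi n x.
Proof.
move=> xX yX; elim: n => //= n IH h.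
have h1 := agree_le (leqnSn n) h; have [-> ->] := IH h1.
rewrite /piece_start /piece_end (h n (ltnSn n)) (agree_iter xX h1 (leqnn _)).
by split; do 2 f_equal; lra.
Qed.

Lemma cyl_lo_in n x : 0 <= x < 1 ->
  0 <= cyl_lo n x < 1 /\ agree n x (cyl_lo n x).
Proof.
move=> xX; apply/cylE => //; have := cyl_bounds n xX => -[]; lra.
Qed.

Lemma cyl_lo_lo n x : 0 <= x < 1 -> cyl_lo n (cyl_lo n x) = cyl_lo n x.
Proof. by move=> xX; have [h1 h2] := cyl_lo_in n xX; have [] := cyl_agree xX h1 h2. Qed.

Lemma cyl_len_gt0 n x : 0 <= x < 1 -> 0 < cyl_len n x.
Proof. move=> /(cyl_bounds n)[]; rewrite /cyl_len; lra. Qed.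

Lemma cyl_sub n m x y : 0 <= x < 1 -> 0 <= y < 1 -> (n <= m)%N -> agree n x y ->
  cyl_lo n x <= cyl_lo m y /\ cyl_hi m y <= cyl_hi n x.
Proof.
move=> xX yX nm /(cyl_agree xX yX)[<- <-].
elim: m nm => [|m IH]; first by rewrite leqn0 => /eqP ->.
rewrite leq_eqVlt => /orP[/eqP -> //|/IH[l h]] /=.
by rewrite le_max l ge_min h.
Qed.

(** Otherwise the cylinder of this right end would start to its left, and
    overlap the cylinder of [x]. *)
Lemma cyl_hi_lo n x : 0 <= x < 1 -> cyl_hi n x < 1 ->
  cyl_lo n (cyl_hi n x) = cyl_hi n x.
Proof.
move=> xX h1; have [a b c _] := cyl_bounds n xX.
have hX : 0 <= cyl_hi n x < 1 by lra.
have [_ l _ _] := cyl_bounds n hX.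
apply/eqP; rewrite eq_le l/= leNgt; apply/negP => l'.
have [zx|zx] := leP x (cyl_lo n (cyl_hi n x)).
- have [zX az] := cyl_lo_in n hX.
  have [] := proj1 (cylE n (cyl_lo n (cyl_hi n x)) xX); first lra.
  move=> _ /agree_trans /(_ (agree_sym az)) ax.
  by have := proj2 (cylE n _ xX) (conj hX ax); rewrite ltxx andbF.
- have [] := proj1 (cylE n x hX); first by have := cyl_bounds n hX => -[]; lra.
  move=> _ /agree_sym ax.
  by have := proj2 (cylE n _ xX) (conj hX ax); rewrite ltxx andbF.
Qed.

(** A cylinder of order at least [k + n] is moved by [T^k] into an
    [n]-cylinder; [cyl_orbit_lo] and [cyl_orbit_hi] below compare their ends.
    *)
Lemma cyl_orbit n m k x y : 0 <= x < 1 -> (k + n <= m)%N ->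
  cyl_lo m x <= y < cyl_hi m x ->
  cyl_lo n (T^(k) x) <= T^(k) x + (y - x) < cyl_hi n (T^(k) x).
Proof.
move=> xX knm /(cylE m y xX)[yX a].
have km : (k <= m)%N by lia.
rewrite -(agree_iter xX a km).
apply/cylE; first exact: iter_iet_in.
by split; [exact: iter_iet_in | exact: agree_shift a].
Qed.

End Dynamics.

(** * Linear recurrence *)

Section Recurrence.
Context {R : realType} {r : nat}.
Variables (lam : 'I_r -> R) (p : 'S_r).
Hypothesis hlam : iet_lengths lam.
Implicit Types (x y z : R) (n m k j : nat).

Local Notation T := (iet lam p).
Local Notation "T^( n ) x" := (iter n T x) (at level 10, x at next level).
Local Notation agree := (agree lam p).

Lemma word_of_orbit x m n : 0 <= x < 1 ->
  exists2 u : seq 'I_r, size u = n &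
    [seq Some i | i <- u] = [seq trajectory lam p x k | k <- iota m n].
Proof.
move=> xX; elim: n m => [|n IH] m; first by exists [::].
have [u su eu] := IH m.+1.
have [i xi _] := pieceP hlam (iter_iet_in p hlam m xX).
exists (i :: u); first by rewrite /= su.
by rewrite /= eu -xi.
Qed.

(** The form in which linear recurrence is used: the whole occurrence of a word
    of length [n] is found within the first [K * n] letters of any trajectory,
    which bounds entrance and return times to [n]-cylinders. The constant is
    increased by one to make it positive. *)
Lemma linearly_recurrent_hit : linearly_recurrent lam p ->
  exists2 K, (0 < K)%N & forall n x y, 0 <= x < 1 -> 0 <= y < 1 ->
    exists2 k, (k + n <= K * n)%N & agree n y (T^(k) x).
Proof.
move=> [K hK]; exists K.+1 => // n x y xX yX.
have [u su eu] := word_of_orbit 0 n yX.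
have [w sw ew] := word_of_orbit 0 (K.+1 * n) xX.
have /infixP[s1 [s2 ws]] : infix u w.
  apply: hK; last by rewrite su sw leq_mul2r leqnSn orbT.
  - by exists y; [rewrite in_itv|exists 0%N; rewrite su].
  - by exists x; [rewrite in_itv|exists 0%N; rewrite sw].
have hs : (size s1 + (n + size s2) = K.+1 * n)%N by rewrite -sw ws !size_cat su.
exists (size s1); first by rewrite -hs leq_add2l leq_addr.
move=> k kn; rewrite -iterD addnC.
have : nth None [seq Some i | i <- u] k =
       nth None [seq Some i | i <- w] (size s1 + k).
  rewrite ws !map_cat nth_cat size_map ltnNge leq_addr/= addKn.
  by rewrite nth_cat size_map su kn.
have kb : (size s1 + k < K.+1 * n)%N by rewrite -hs ltn_add2l ltn_addr.
by rewrite eu ew !(nth_map 0%N) ?size_iota// !nth_iota.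
Qed.

Variable K : nat.
Hypothesis K0 : (0 < K)%N.
Hypothesis hit : forall n x y, 0 <= x < 1 -> 0 <= y < 1 ->
  exists2 k, (k + n <= K * n)%N & agree n y (T^(k) x).
Hypothesis aper : forall j, (0 < j)%N -> exists2 y, 0 <= y < 1 & T^(j) y <> y.

(** If a word of length [n >= K * (j + 1)] overlaps itself with shift [j], it
    has period [j] and contains all words of length [j + 1]; then all
    trajectories have period [j], each orbit advances by a constant translation
    every [j] steps, and staying in [0, 1[ forces this translation to vanish.
    *)
Lemma no_early_return n j x : 0 <= x < 1 -> (0 < j)%N -> (K * j.+1 <= n)%N ->
  ~ agree n x (T^(j) x).
Proof.
move=> xX j0 jn a.
have per y : 0 <= y < 1 -> piece lam (T^(j) y) = piece lam y.
  move=> yX; have [k kj ak] := hit j.+1 xX yX.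
  rewrite (ak j (ltnSn j)) (ak 0%N (ltn0Sn _))/=.
  by rewrite -iterD addnC iterD -(a k)//; lia.
have [y yX yj] := aper j0.
have step m : T^(m * j) y = y + m%:R * (T^(j) y - y).
  elim: m => [|m IH]; first by rewrite mul0r addr0.
  rewrite mulSnr iterD (agree_iter hlam (n := m * j) yX)//.
    by rewrite IH -natr1; lra.
  by move=> k _; rewrite -iterD addnC iterD per// iter_iet_in.
pose d := T^(j) y - y.
have d0 : 0 < `|d| by rewrite normr_gt0 subr_eq0; apply/eqP.
have /archi_boundP : 0 <= `|d|^-1 by rewrite invr_ge0 ltW.
set m := Num.bound _ => hm.
have md : 1 < m%:R * `|d| by rewrite mulrC -ltr_pdivrMl// mulr1.
have mX := iter_iet_in p hlam (m * j) yX; rewrite step -/d in mX.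
case: (ger0P d) md => _; first lra.
by rewrite mulrN; lra.
Qed.

Hypothesis len_lo : forall n x, 0 <= x < 1 -> (0 < n)%N ->
  1 <= cyl_len lam p n x * (K * n)%:R.

(** If [T^j x] were too close to [x], it would be so for all points of the
    cylinder of [x] of order [K * (j + 1)], and one of them, near an end chosen
    according to the sign of the translation, would return to this cylinder at
    time [j], too early. *)
Lemma return_dist n j x : 0 <= x < 1 -> (0 < j <= n)%N ->
  1 <= `|T^(j) x - x| * (2 * K ^ 2 * n)%:R.
Proof.
move=> xX /andP[j0 jn]; rewrite leNgt; apply/negP => small.
pose N := (K * j.+1)%N.
have N0 : (0 < N)%N by rewrite muln_gt0 K0.
set tau := T^(j) x - x in small.
have taul : `|tau| < cyl_len lam p N x.
  rewrite ltNge; apply/negP => h.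
  have := len_lo xX N0; apply/negP; rewrite -ltNge (le_lt_trans _ small)//.
  apply: ler_pM => //; first by rewrite ltW// cyl_len_gt0.
  rewrite ler_nat /N mulnA (_ : (2 * K ^ 2 * n = K * K * (2 * n))%N).
    by rewrite leq_mul//; lia.
  by rewrite -mulnn; ring.
have jN : (j <= N)%N by rewrite /N; have := leq_mul K0 (leqnn j.+1); lia.
have [l0 lx xh h1] := cyl_bounds p hlam N xX.
pose y := if 0 <= tau then cyl_lo lam p N x else cyl_lo lam p N x - tau.
have hy : cyl_lo lam p N x <= y < cyl_hi lam p N x /\
          cyl_lo lam p N x <= y + tau < cyl_hi lam p N x.
  by move: taul; rewrite /y /cyl_len; case: (ger0P tau) => ? ?; split; lra.
have [/(cylE p hlam N y xX)[yX ay] /(cylE p hlam N (y + tau) xX)[ytX ayt]] := hy.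
apply: (@no_early_return N j y yX j0 (leqnn _)).
have -> : T^(j) y = y + tau by rewrite (agree_iter hlam xX ay jN) /tau; lra.
exact: agree_trans (agree_sym ay) ayt.
Qed.

End Recurrence.

(** * Interval functions and ends of cylinders *)

Section Cuts.
Context {R : realType} {r : nat}.
Variables (lam : 'I_r -> R) (p : 'S_r).
Hypothesis hlam : iet_lengths lam.
Local Notation T := (iet lam p).
Local Notation "T^( n ) x" := (iter n T x) (at level 10, x at next level).
Implicit Types (x y a b c e : R) (n m k j : nat).
Local Notation agree := (agree lam p).
Local Notation cyl_lo := (cyl_lo lam p).
Local Notation cyl_hi := (cyl_hi lam p).
Local Notation cyl_len := (cyl_len lam p).

(** The ends of the [n]-cylinders, including 1. *)
Definition cyl_cut n c := c = 1 \/ (0 <= c < 1 /\ cyl_lo n c = c).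

Lemma cyl_cut_le n m c : (n <= m)%N -> cyl_cut n c -> cyl_cut m c.
Proof.
move=> nm [->|[cX lc]]; [by left|right; split => //].
have [l _] := cyl_sub hlam cX cX nm (@agree_refl _ _ lam p n c).
have [_ l' _ _] := cyl_bounds p hlam m cX.
by apply/eqP; rewrite eq_le l' -{1}lc l.
Qed.

Lemma cyl_cut_lo n x : 0 <= x < 1 -> cyl_cut n (cyl_lo n x).
Proof.
by move=> xX; right; split; [have [] := cyl_lo_in p hlam n xX | exact: cyl_lo_lo].
Qed.

Lemma cyl_cut_hi n x : 0 <= x < 1 -> cyl_cut n (cyl_hi n x).
Proof.
move=> xX; have [h0 h1 h2 h3] := cyl_bounds p hlam n xX.
have [h4|h4] := ltP (cyl_hi n x) 1; [right|left; lra].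
by split; [lra|exact: cyl_hi_lo].
Qed.

Lemma cyl_orbit_lo n m k x : 0 <= x < 1 -> (k + n <= m)%N ->
  cyl_lo n (T^(k) x) <= T^(k) x + (cyl_lo m x - x).
Proof.
move=> xX knm; have [h0 h1 h2 h3] := cyl_bounds p hlam m xX.
have := @cyl_orbit _ _ lam p hlam n m k x (cyl_lo m x) xX knm.
by move=> /(_ ltac:(lra)) /andP[].
Qed.

Lemma cyl_orbit_hi n m k x : 0 <= x < 1 -> (k + n <= m)%N ->
  T^(k) x + (cyl_hi m x - x) <= cyl_hi n (T^(k) x).
Proof.
move=> xX knm; have [h0 h1 h2 h3] := cyl_bounds p hlam m xX.
have [g0 g1 g2 g3] := cyl_bounds p hlam n (iter_iet_in p hlam k xX).
rewrite leNgt; apply/negP => hh.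
have := @cyl_orbit _ _ lam p hlam n m k x (x + (cyl_hi n (T^(k) x) - T^(k) x)) xX knm.
by move=> /(_ ltac:(lra)); lra.
Qed.

Definition interval_additive (psi : R -> R -> R) : Prop :=
  forall a b c, 0 <= a -> a <= b -> b <= c -> c <= 1 -> psi a c = psi a b + psi b c.

Variable K : nat.
Hypothesis K0 : (0 < K)%N.
Hypothesis len_lo : forall n x, 0 <= x < 1 -> (0 < n)%N ->
  1 <= cyl_len n x * (K * n)%:R.
Hypothesis len_hi : forall n x, 0 <= x < 1 -> cyl_len n x * n%:R <= (2 * K)%:R.

(** An interval between two ends is a finite union of [n]-cylinders; the lower
    bound on their lengths makes the induction terminate. *)
Lemma cylinder_average psi n a b : (0 < n)%N -> interval_additive psi ->
  0 <= a -> a <= b -> b <= 1 -> cyl_cut n a -> cyl_cut n b ->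
  (forall x, 0 <= x < 1 -> a <= cyl_lo n x -> cyl_hi n x <= b ->
     0 <= psi (cyl_lo n x) (cyl_hi n x)) ->
  0 <= psi a b.
Proof.
move=> n0 add a0 ab b1 ca cb pos.
have [m] : exists m, (b - a) * (K * n)%:R <= m%:R.
  exists (Num.bound ((b - a) * (K * n)%:R)).
  by apply/ltW/archi_boundP; rewrite mulr_ge0// subr_ge0.
elim: m a a0 ab ca pos => [|m IH] a a0 ab ca pos.
  have Kn0 : 0 < (K * n)%:R :> R by rewrite ltr0n muln_gt0 K0.
  rewrite pmulr_lle0// => ba.
  have -> : b = a by lra.
  by have := add a a a a0 (lexx _) (lexx _) ltac:(lra); lra.
move: ab; rewrite le_eqVlt => /orP[/eqP e _|ab].
  rewrite -e; have := add a a a a0 (lexx _) (lexx _) ltac:(lra); lra.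
move=> hm.
have [aX la] : 0 <= a < 1 /\ cyl_lo n a = a by case: ca => // a1; lra.
have [h0 h1 h2 h3] := cyl_bounds p hlam n aX.
have hb : cyl_hi n a <= b.
  rewrite leNgt; apply/negP => hb.
  have [bX lb] : 0 <= b < 1 /\ cyl_lo n b = b by case: cb => // b1'; lra.
  have [|_ ag] := proj1 (cylE p hlam n b aX); first lra.
  by have [] := cyl_agree hlam aX bX ag; lra.
have pa := pos a aX; rewrite la in pa.
rewrite (add a (cyl_hi n a) b)//; last by lra.
apply: addr_ge0; first exact: pa.
apply: IH => //; [lra|exact: cyl_cut_hi| |].
  by move=> x xX ax xb; apply: pos => //; lra.
have := len_lo aX n0; rewrite /cyl_len la.
by move: hm; rewrite -natr1; lra.
Qed.

(** In the applications [c] is close to the supremum [s] of the densities of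
    [phi] over all intervals. Then the density cannot be concentrated on a part
    of the cylinder ([good_density]), and averaging produces good cylinders of
    all higher orders inside a given one ([good_refine]). *)
Definition good (phi : R -> R -> R) (c : R) n x :=
  c * cyl_len n x < phi (cyl_lo n x) (cyl_hi n x).

Lemma good_refine phi c n m x : interval_additive phi -> (0 < m)%N -> (n <= m)%N ->
  0 <= x < 1 -> good phi c n x ->
  exists y, [/\ 0 <= y < 1, agree n x y & good phi c m y].
Proof.
move=> add m0 nm xX gx; apply: contrapT => no.
have [h0 h1 h2 h3] := cyl_bounds p hlam n xX.
pose psi a b := c * (b - a) - phi a b.
suff : 0 <= psi (cyl_lo n x) (cyl_hi n x).
  by move: gx; rewrite /good /psi /cyl_len; lra.
apply: (cylinder_average m0) => //; first 1 last.
- lra.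
- exact: cyl_cut_le nm (cyl_cut_lo _ _).
- exact: cyl_cut_le nm (cyl_cut_hi _ _).
- move=> y yX ly hy; rewrite /psi leNgt; apply/negP => gy; apply: no.
  exists y; split => //; last by rewrite /good /cyl_len; lra.
  have [g0 g1 g2 g3] := cyl_bounds p hlam m yX.
  have [|_ //] := proj1 (cylE p hlam n y xX); lra.
- by move=> u v w u0 uv vw w1; rewrite /psi (add u v w)//; lra.
Qed.

(** An interval of density more than [c] contains a cylinder with the same
    property: the two incomplete cylinders at its ends have a mass of order
    [1 / n], which is absorbed by the strict excess [gap] once [n] is large. *)
Lemma good_start phi s c a b : interval_additive phi ->
  (forall u v, 0 <= u -> u <= v -> v <= 1 -> phi u v <= s * (v - u)) ->
  0 <= c <= s -> 0 <= a -> a < b -> b <= 1 -> c * (b - a) < phi a b ->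
  exists n x, [/\ (0 < n)%N, 0 <= x < 1 & good phi c n x].
Proof.
move=> add phi_le cs a0 ab b1 gab; apply: contrapT => no.
pose gap := Num.min (b - a) (phi a b - c * (b - a)).
have gap0 : 0 < gap by rewrite lt_min; lra.
pose q := (4 * K)%:R * (s + 1) / gap.
have q0 : 0 <= q by apply: divr_ge0; [apply: mulr_ge0 => //; lra|exact: ltW].
pose n := (Num.bound q).+1.
have nq : (4 * K)%:R * (s + 1) < gap * n%:R.
  rewrite -ltr_pdivrMl// mulrC; apply: (lt_trans (archi_boundP q0)).
  by rewrite ltr_nat.
have n0 : 0 < n%:R :> R by rewrite ltr0n.
have aX : 0 <= a < 1 by lra.
have la := len_hi n aX; have [a2 a3 a4 a5] := cyl_bounds p hlam n aX.
pose b' := if b < 1 then cyl_lo n b else 1.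
have [cb b'b b'1 lb] : [/\ cyl_cut n b', b' <= b, 0 <= b' & (b - b') * n%:R <= (2 * K)%:R].
  rewrite /b'; case: ltP => hb; last first.
    split; [by left|lra|lra|].
    by have -> : b - 1 = 0 by [lra]; rewrite mul0r ler0n.
  have bX : 0 <= b < 1 by lra.
  have := len_hi n bX; have [b2 b3 b4 b5] := cyl_bounds p hlam n bX.
  split => //; first exact: cyl_cut_lo.
  by apply: le_trans (len_hi n bX); rewrite ler_pM2r// /cyl_len; lra.
have s0 : 0 <= s by lra.
have gn : gap * n%:R <= (b - a) * n%:R by rewrite ler_pM2r// ge_min lexx.
have gn' : gap * n%:R <= (phi a b - c * (b - a)) * n%:R.
  by rewrite ler_pM2r// ge_min lexx orbT.
have ha : (cyl_hi n a - a) * n%:R <= (2 * K)%:R.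
  by apply: le_trans la; rewrite ler_pM2r// /cyl_len; lra.
have K4 : (4 * K)%:R = 2 * (2 * K)%:R :> R by rewrite -natrM mulnA.
have K2 : 0 <= (2 * K)%:R :> R by exact: ler0n.
have Ks : 0 <= s * (2 * K)%:R by rewrite mulr_ge0.
have ab' : cyl_hi n a <= b'.
  rewrite -subr_ge0 -(pmulr_lge0 _ n0); nra.
pose psi u v := c * (v - u) - phi u v.
have : 0 <= psi (cyl_hi n a) b'.
  apply: (@cylinder_average _ n) => //; first 1 last.
  - lra.
  - lra.
  - exact: cyl_cut_hi.
  - move=> y yX ly hy; rewrite /psi leNgt; apply/negP => gy; apply: no.
    by exists n, y; split => //; rewrite /good /cyl_len; lra.
  - by move=> u v w u0 uv vw w1; rewrite /psi (add u v w)//; lra.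
rewrite -(pmulr_lge0 _ n0) /psi => hpsi.
have e1 := add a (cyl_hi n a) b a0 ltac:(lra) ltac:(lra) b1.
have e2 := add (cyl_hi n a) b' b ltac:(lra) ab' b'b b1.
have p1 := phi_le a (cyl_hi n a) a0 ltac:(lra) ltac:(lra).
have p2 := phi_le b' b b'1 b'b b1.
have p1' : phi a (cyl_hi n a) * n%:R <= s * (2 * K)%:R.
  apply: le_trans (_ : s * (cyl_hi n a - a) * n%:R <= _); first by rewrite ler_pM2r.
  by rewrite -mulrA ler_wpM2l.
have p2' : phi b' b * n%:R <= s * (2 * K)%:R.
  apply: le_trans (_ : s * (b - b') * n%:R <= _); first by rewrite ler_pM2r.
  by rewrite -mulrA ler_wpM2l.
have c1 : 0 <= c * (cyl_hi n a - a) * n%:R.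
  by rewrite !mulr_ge0//; lra.
have c2 : 0 <= c * (b - b') * n%:R.
  by rewrite !mulr_ge0//; lra.
move: gn' nq hpsi; rewrite e1 e2 K4; nra.
Qed.

(** What is missing in a subinterval is at most what is missing in the whole
    cylinder, since the density is at most [s] on the two remaining parts. *)
Lemma good_density phi s e n x a b : interval_additive phi ->
  (forall u v, 0 <= u -> u <= v -> v <= 1 -> phi u v <= s * (v - u)) ->
  0 <= x < 1 -> good phi (s - e) n x ->
  cyl_lo n x <= a -> a <= b -> b <= cyl_hi n x ->
  s * (b - a) - e * cyl_len n x <= phi a b.
Proof.
move=> add phi_le xX; rewrite /good /cyl_len => gx la ab bh.
have [h0 h1 h2 h3] := cyl_bounds p hlam n xX.
have e1 := add (cyl_lo n x) a (cyl_hi n x) h0 la ltac:(lra) h3.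
have e2 := add a b (cyl_hi n x) ltac:(lra) ab bh h3.
have p1 := phi_le (cyl_lo n x) a h0 la ltac:(lra).
have p2 := phi_le b (cyl_hi n x) ltac:(lra) bh h3.
by lra.
Qed.

Lemma cyl_cut0 n : cyl_cut n 0.
Proof.
have X0 : 0 <= (0 : R) < 1 by rewrite lexx ltr01.
by right; split => //; have := cyl_bounds p hlam n X0 => -[]; lra.
Qed.

End Cuts.

(** * Unique ergodicity of the exchange *)

Section UniqueMass.
Context {R : realType} {r : nat}.
Variables (lam : 'I_r -> R) (p : 'S_r).
Hypothesis hlam : iet_lengths lam.
Local Notation T := (iet lam p).
Local Notation "T^( n ) x" := (iter n T x) (at level 10, x at next level).
Implicit Types (x y a b c e : R) (n m k j : nat).
Local Notation agree := (agree lam p).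
Local Notation cyl_lo := (cyl_lo lam p).
Local Notation cyl_hi := (cyl_hi lam p).
Local Notation cyl_len := (cyl_len lam p).
Local Notation cyl_cut := (cyl_cut lam p).

Variable K : nat.
Hypothesis K0 : (0 < K)%N.
Hypothesis len_lo : forall n x, 0 <= x < 1 -> (0 < n)%N ->
  1 <= cyl_len n x * (K * n)%:R.
Hypothesis len_hi : forall n x, 0 <= x < 1 -> cyl_len n x * n%:R <= (2 * K)%:R.

Hypothesis hit : forall n x y, 0 <= x < 1 -> 0 <= y < 1 ->
  exists2 k, (k + n <= K * n)%N & agree n y (T^(k) x).

Variable nu : R -> R -> R.
Hypothesis nu_add : interval_additive nu.
Hypothesis nu_ge0 : forall a b, 0 <= a -> a <= b -> b <= 1 -> 0 <= nu a b.
Hypothesis nu_hi : forall n x, 0 <= x < 1 ->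
  nu (cyl_lo n x) (cyl_hi n x) * n%:R <= (2 * K)%:R.
Hypothesis nu_transport : forall k x a b, 0 <= x < 1 ->
  cyl_lo k x <= a -> a <= b -> b <= cyl_hi k x ->
  nu (T^(k) x + (a - x)) (T^(k) x + (b - x)) = nu a b.
Hypothesis nu01 : nu 0 1 = 1.

Lemma mass_le_cut n a b : (0 < n)%N -> 0 <= a -> a <= b -> b <= 1 ->
  cyl_cut n a -> cyl_cut n b -> nu a b <= (2 * K * K)%:R * (b - a).
Proof.
move=> n0 a0 ab b1 ca cb; rewrite -subr_ge0.
pose psi u v := (2 * K * K)%:R * (v - u) - nu u v.
apply: (cylinder_average hlam K0 len_lo (psi := psi) (n := n)) => //.
  by move=> u v w u0 uv vw w1; rewrite /psi (nu_add u0 uv vw w1); lra.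
move=> x xX _ _; rewrite /psi subr_ge0 -/(cyl_len n x).
have n0' : 0 < n%:R :> R by rewrite ltr0n.
rewrite -(ler_pM2r n0'); apply: le_trans (nu_hi n xX) _.
have -> : (2 * K * K)%:R * cyl_len n x * n%:R =
  (2 * K)%:R * (cyl_len n x * (K * n)%:R) by rewrite !natrM; ring.
by rewrite -[leLHS]mulr1 ler_wpM2l ?ler0n// len_lo.
Qed.

(** Enlarging [a, b[ to a union of cylinders of high order costs arbitrarily
    little. *)
Lemma mass_le_lipschitz a b : 0 <= a -> a <= b -> b <= 1 ->
  nu a b <= (2 * K * K)%:R * (b - a).
Proof.
move=> a0 ab b1; rewrite leNgt; apply/negP => gap.
set C := (2 * K * K)%:R in gap.
have C0 : 0 <= C by exact: ler0n.
pose g := nu a b - C * (b - a).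
have g0 : 0 < g by rewrite /g; lra.
pose q := C * (4 * K)%:R / g.
have q0 : 0 <= q by apply: divr_ge0; [apply: mulr_ge0; rewrite ?ler0n|exact: ltW].
pose n := (Num.bound q).+1.
have nq : C * (4 * K)%:R < g * n%:R.
  rewrite -ltr_pdivrMl// mulrC; apply: (lt_trans (archi_boundP q0)).
  by rewrite ltr_nat.
have n0 : 0 < n%:R :> R by rewrite ltr0n.
have nu0 x : 0 <= x <= 1 -> nu x x = 0.
  by move=> x01; have := @nu_add x x x ltac:(lra) ltac:(lra) ltac:(lra) ltac:(lra); lra.
have aX : 0 <= a < 1.
  by rewrite a0 lt_neqAle; move: g0; rewrite /g; case: eqVneq => [a1|_ _]; [
     have -> : b = a by [lra]; rewrite nu0; lra | lra].
have la := len_hi n aX; have [a2 a3 a4 a5] := cyl_bounds p hlam n aX.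
have ha : (a - cyl_lo n a) * n%:R <= (2 * K)%:R.
  by apply: le_trans la; rewrite ler_pM2r// /cyl_len; lra.
have [b' [cb bb' b'1 hb]] :
    exists b', [/\ cyl_cut n b', b <= b', b' <= 1 & (b' - b) * n%:R <= (2 * K)%:R].
  have [b1'|b1'] := ltP b 1.
    have bX : 0 <= b < 1 by lra.
    have [b2 b3 b4 b5] := cyl_bounds p hlam n bX.
    exists (cyl_hi n b); split => //; [exact: cyl_cut_hi|lra|].
    by apply: le_trans (len_hi n bX); rewrite ler_pM2r// /cyl_len; lra.
  exists 1; split => //; first by left.
  by have -> : 1 - b = 0 by [lra]; rewrite mul0r ler0n.
have mono : nu a b <= nu (cyl_lo n a) b'.
  have e1 := @nu_add (cyl_lo n a) a b' a2 a3 ltac:(lra) b'1.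
  have e2 := @nu_add a b b' a0 ab bb' b'1.
  have := @nu_ge0 (cyl_lo n a) a a2 a3 ltac:(lra).
  have := @nu_ge0 b b' ltac:(lra) bb' b'1.
  by lra.
have := @mass_le_cut n (cyl_lo n a) b' isT a2 ltac:(lra) b'1 (cyl_cut_lo p hlam n aX) cb.
rewrite -/C => le1.
have le2 : g <= C * ((a - cyl_lo n a) + (b' - b)) by rewrite /g; lra.
have : g * n%:R <= C * ((a - cyl_lo n a) * n%:R + (b' - b) * n%:R).
  by rewrite -mulrDl mulrA ler_pM2r.
have : C * ((a - cyl_lo n a) * n%:R + (b' - b) * n%:R) <= C * (4 * K)%:R.
  have K4 : (4 * K)%:R = 2 * (2 * K)%:R :> R by rewrite -natrM mulnA.
  by rewrite ler_wpM2l// K4; lra.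
by lra.
Qed.

(** Let [s] be the supremum of the densities, and suppose [s > 1]. Take an
    [n]-cylinder [J] of density almost [s]. Every cylinder of order
    [(K + 1) * n] is translated into [J] in time at most [K * n], and occupies
    there a definite proportion of [J], so its density too is almost [s], in
    particular at least [(s + 1) / 2]. Summing over all of them, the total mass
    exceeds 1. *)
Lemma mass_le_length a b : 0 <= a -> a <= b -> b <= 1 -> nu a b <= b - a.
Proof.
pose E := [set t : R | exists u v, [/\ 0 <= u, u < v, v <= 1 & t = nu u v / (v - u)]]%classic.
have hE : has_sup E.
  split; first by exists (nu 0 1 / (1 - 0)), 0, 1; split.
  exists (2 * K * K)%:R => _ [u [v [u0 uv v1 ->]]].
  by rewrite ler_pdivrMr ?subr_gt0// mass_le_lipschitz// ltW.
pose s := sup E.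
have phi_le u v : 0 <= u -> u <= v -> v <= 1 -> nu u v <= s * (v - u).
  move=> u0; rewrite le_eqVlt => /orP[/eqP uv v1|uv v1].
    by rewrite uv in u0 *; have := @nu_add v v v ltac:(lra) (lexx _) (lexx _) v1; lra.
  rewrite -ler_pdivrMr ?subr_gt0//; apply: sup_upper_bound => //.
  by exists u, v.
have [s1|s1] := leP s 1.
  move=> a0 ab b1; apply: le_trans (phi_le a b a0 ab b1) _.
  by rewrite ler_piMl// subr_ge0.
exfalso.
(* a cylinder of order (K + 1) * n occupies at least the proportion 1 / Q of
   an n-cylinder *)
pose Q : R := (2 * K * (K * K.+1))%:R.
have Q1 : 1 <= Q by rewrite ler1n !muln_gt0 K0.
pose e := (s - 1) / 2 / Q.
have e0 : 0 < e by rewrite !divr_gt0//; lra.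
have eQ : e * Q = (s - 1) / 2 by rewrite /e divfK//; lra.
have es : e <= s - 1 by nra.
have [_ [u [v [u0 uv v1 ->]]]] := sup_adherent e0 hE.
rewrite -/s ltr_pdivlMr ?subr_gt0// => near.
have cs : 0 <= s - e <= s by lra.
have [n [x [n0 xX gx]]] := good_start hlam K0 len_lo len_hi nu_add phi_le cs u0 uv v1 near.
pose L := (K.+1 * n)%N.
have L0 : (0 < L)%N by rewrite muln_gt0.
have n0' : 0 < n%:R :> R by rewrite ltr0n.
pose psi a b := nu a b - (s + 1) / 2 * (b - a).
have : 0 <= psi 0 1; last by rewrite /psi nu01; lra.
apply: (cylinder_average hlam K0 len_lo (psi := psi) (n := L)) => //.
- by move=> a' b' c a0 ab bc c1; rewrite /psi (nu_add a0 ab bc c1); lra.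
- exact: cyl_cut0.
- by left.
move=> y yX _ _; rewrite /psi subr_ge0 -/(cyl_len L y).
have [k kn ag] := hit n yX xX.
have kX := iter_iet_in p hlam k yX.
have [el eh] := cyl_agree hlam xX kX ag.
have kL : (k + n <= L)%N by rewrite /L mulSn (leq_trans kn)// leq_addl.
have lo := cyl_orbit_lo p hlam yX kL; have hi := cyl_orbit_hi p hlam yX kL.
rewrite el in lo; rewrite eh in hi.
have [y0 y1 y2 y3] := cyl_bounds p hlam L yX.
have kl : (k <= L)%N by exact: leq_trans (leq_addr n k) kL.
have [l1 h1] := cyl_sub hlam yX yX kl (@agree_refl _ _ lam p k y).
have lh : T^(k) y + (cyl_lo L y - y) <= T^(k) y + (cyl_hi L y - y) by lra.
have lh' : cyl_lo L y <= cyl_hi L y by lra.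
have := good_density hlam nu_add phi_le xX gx lo lh hi.
rewrite (nu_transport yX l1 lh' h1).
have : e * cyl_len n x <= (s - 1) / 2 * cyl_len L y.
  rewrite -(ler_pM2r n0') -eQ.
  apply: le_trans (_ : e * (2 * K)%:R <= _).
    by rewrite -mulrA ler_wpM2l ?len_hi// ltW.
  have := len_lo yX L0.
  have -> : e * Q * cyl_len L y * n%:R = e * (2 * K)%:R * (cyl_len L y * (K * L)%:R).
    by rewrite /Q /L !natrM; ring.
  by move=> h; rewrite -[leLHS]mulr1 ler_wpM2l// mulr_ge0 ?ler0n// ltW.
by rewrite /cyl_len; lra.
Qed.

Lemma mass_eq_length a b : 0 <= a -> a <= b -> b <= 1 -> nu a b = b - a.
Proof.
move=> a0 ab b1.
have e1 := @nu_add 0 a 1 (lexx _) a0 ltac:(lra) (lexx _).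
have e2 := @nu_add a b 1 a0 ab b1 (lexx _).
have := @mass_le_length 0 a (lexx _) a0 ltac:(lra).
have := @mass_le_length a b a0 ab b1.
have := @mass_le_length b 1 ltac:(lra) b1 (lexx _).
by rewrite nu01 in e1; lra.
Qed.

End UniqueMass.

(** * First returns to a cylinder *)

Section Returns.
Context {R : realType} {r : nat}.
Variables (lam : 'I_r -> R) (p : 'S_r).
Hypothesis hlam : iet_lengths lam.
Local Notation T := (iet lam p).
Local Notation "T^( n ) x" := (iter n T x) (at level 10, x at next level).
Implicit Types (x y z u v : R) (n m k j q : nat).
Local Notation agree := (agree lam p).
Local Notation cyl_lo := (cyl_lo lam p).
Local Notation cyl_hi := (cyl_hi lam p).

Variable K : nat.
Hypothesis hit : forall n x y, 0 <= x < 1 -> 0 <= y < 1 ->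
  exists2 k, (k + n <= K * n)%N & agree n y (T^(k) x).

Definition hit_time n y x : nat :=
  xget 0%N [set k | agree n y (T^(k) x) /\
                    forall i, (i < k)%N -> ~ agree n y (T^(i) x)]%classic.

Lemma hit_timeP n y x : 0 <= x < 1 -> 0 <= y < 1 ->
  [/\ (hit_time n y x + n <= K * n)%N, agree n y (T^(hit_time n y x) x) &
      forall i, (i < hit_time n y x)%N -> ~ agree n y (T^(i) x)].
Proof.
move=> xX yX; have [k kn ak] := hit n xX yX.
have ex : exists k, `[< agree n y (T^(k) x) >] by exists k; apply/asboolP.
have [m /asboolP am mmin] := ex_minnP ex.
have mk : (m <= k)%N by apply/mmin/asboolP.
have sm : [set k | agree n y (T^(k) x) /\
      forall i, (i < k)%N -> ~ agree n y (T^(i) x)]%classic m.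
  split=> // i im /asboolP /mmin; rewrite leqNgt im //.
have := @xgetPex _ 0%N _ (ex_intro _ m sm).
rewrite -/(hit_time n y x) => -[ah hh]; split => //.
apply: leq_trans kn; rewrite leq_add2r; apply: leq_trans mk.
by rewrite leqNgt; apply/negP => /hh; exact.
Qed.

Lemma hit_time0 n y x : 0 <= x < 1 -> 0 <= y < 1 -> agree n y x ->
  hit_time n y x = 0%N.
Proof.
move=> xX yX a; have [_ _ h] := hit_timeP n xX yX.
by case: (posnP (hit_time n y x)) => // /h; case.
Qed.

Lemma hit_timeS n y x : 0 <= x < 1 -> 0 <= y < 1 -> ~ agree n y x ->
  hit_time n y x = (hit_time n y (T x)).+1.
Proof.
move=> xX yX a; have [_ h1 h2] := hit_timeP n xX yX.
have [_ g1 g2] := hit_timeP n (iet_in p hlam xX) yX.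
case E : (hit_time n y x) => [|m]; first by rewrite E in h1; case: a.
rewrite E in h1 h2; congr _.+1.
case: (ssrnat.ltngtP m (hit_time n y (T x))) => // lt.
- by case: (g2 _ lt); rewrite -iterSr.
- by case: (h2 (hit_time n y (T x)).+1); rewrite ?ltnS// iterSr.
Qed.

Definition ret_time n y x : nat := (hit_time n y (T x)).+1.

Lemma ret_timeP n y x : 0 <= x < 1 -> 0 <= y < 1 ->
  [/\ (ret_time n y x + n <= (K * n).+1)%N, agree n y (T^(ret_time n y x) x) &
      forall i, (0 < i < ret_time n y x)%N -> ~ agree n y (T^(i) x)].
Proof.
move=> xX yX; have [h1 h2 h3] := hit_timeP n (iet_in p hlam xX) yX.
split; [by rewrite addSn ltnS|by rewrite iterSr|].
by move=> [//|i] /h3; rewrite iterSr.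
Qed.

Lemma ret_index n y x i : 0 <= x < 1 -> 0 <= y < 1 -> (i < ret_time n y x)%N ->
  (i + n <= K * n)%N.
Proof.
move=> xX yX iq; have [h _ _] := ret_timeP n xX yX.
by rewrite -ltnS -addSn; apply: leq_trans h; rewrite leq_add2r.
Qed.

(** A return time [q] satisfies [q + n <= K * n + 1], so that the coding up to
    time [(K + 1) * n] determines it. *)
Lemma ret_time_agree n y x x' : 0 <= x < 1 -> 0 <= x' < 1 -> 0 <= y < 1 ->
  (0 < n)%N -> agree (K.+1 * n) x x' -> ret_time n y x = ret_time n y x'.
Proof.
wlog : x x' / (ret_time n y x < ret_time n y x')%N.
  move=> W xX x'X yX n0 a.
  case: (ssrnat.ltngtP (ret_time n y x) (ret_time n y x')) => // lt.
    exact: W.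
  by rewrite (W x' x)//; exact: agree_sym.
move=> lt xX x'X yX n0 a; exfalso.
have [h1 h2 _] := ret_timeP n xX yX; have [_ _ h3] := ret_timeP n x'X yX.
apply: (h3 (ret_time n y x)); first by rewrite lt.
apply: agree_trans h2 _; apply: agree_shift a.
by apply: leq_trans h1 _; rewrite mulSn -add1n leq_add2r.
Qed.

Section Cocycle.
Variable V : zmodType.
Variable f : R -> V.

Definition birkhoff k x : V := \sum_(i < k) f (T^(i) x).

Lemma birkhoffS k x : birkhoff k.+1 x = f x + birkhoff k (T x).
Proof.
rewrite /birkhoff big_ord_recl; congr (_ + _).
by apply: eq_bigr => i _; rewrite -iterSr.
Qed.

Definition ret_sum n y x : V := birkhoff (ret_time n y x) x.

(** Going from [x] forward to the cylinder defines a function whose coboundary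
    cancels [f] off the cylinder, and replaces it by the return cocycle on it
    ([transfer_out], [transfer_in]). *)
Definition transfer n y x : V := - birkhoff (hit_time n y x) x.

Lemma transfer0 n y x : 0 <= x < 1 -> 0 <= y < 1 -> agree n y x ->
  transfer n y x = 0.
Proof. by move=> xX yX a; rewrite /transfer hit_time0// /birkhoff big_ord0 oppr0. Qed.

Lemma transfer_in n y x : 0 <= x < 1 -> 0 <= y < 1 -> agree n y x ->
  f x + transfer n y x - transfer n y (T x) = ret_sum n y x.
Proof.
move=> xX yX a; rewrite transfer0// addr0 /transfer opprK.
by rewrite /ret_sum /ret_time birkhoffS.
Qed.

Lemma transfer_out n y x : 0 <= x < 1 -> 0 <= y < 1 -> ~ agree n y x ->
  f x + transfer n y x - transfer n y (T x) = 0.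
Proof.
move=> xX yX a; rewrite /transfer (hit_timeS xX yX a) birkhoffS opprK opprD.
by rewrite addrA subrr add0r addNr.
Qed.

Lemma birkhoff_transfer n y k x :
  birkhoff k x + transfer n y x - transfer n y (T^(k) x) =
  \sum_(i < k) (f (T^(i) x) + transfer n y (T^(i) x) - transfer n y (T (T^(i) x))).
Proof.
under eq_bigr do rewrite -addrA.
rewrite big_split/= -addrA; congr (_ + _).
have := telescope_sumr (fun i => transfer n y (T^(i) x)) (leq0n k).
rewrite big_mkord => /(congr1 -%R); rewrite opprB -sumrN => <-.
by apply: eq_bigr => i _; rewrite opprB.
Qed.

(** Going backwards from [z], the cylinder is met within time [K * n]; [P] is
    the last visit before [z]. *)
Lemma entry n y z : 0 <= z < 1 -> 0 <= y < 1 ->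
  exists P m, [/\ 0 <= P < 1, agree n y P, (m < ret_time n y P)%N & T^(m) P = z].
Proof.
move=> zX yX.
have [x0 x0X x0z] := iter_iet_surj p hlam (K * n) zX.
have [k kn ak] := hit n x0X yX.
pose Q m := exists P, [/\ 0 <= P < 1, agree n y P & T^(m) P = z].
have ex : exists m, `[< Q m >].
  exists (K * n - k)%N; apply/asboolP; exists (T^(k) x0).
  split => //; first exact: iter_iet_in.
  by rewrite -iterD subnK//; exact: leq_trans (leq_addr n k) kn.
have [m /asboolP[P [PX aP Pz]] mmin] := ex_minnP ex.
exists P, m; split => //; rewrite ltnNge; apply/negP => qm.
have [_ h2 _] := ret_timeP n PX yX.
have /mmin : `[< Q (m - ret_time n y P)%N >].
  apply/asboolP; exists (T^(ret_time n y P) P).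
  by split => //; [exact: iter_iet_in|rewrite -iterD subnK].
by rewrite leqNgt ltn_subrL (leq_trans _ qm).
Qed.

Lemma entry_unique n y P P' m m' : 0 <= P < 1 -> 0 <= P' < 1 -> 0 <= y < 1 ->
  agree n y P -> agree n y P' -> (m < ret_time n y P)%N -> (m' < ret_time n y P')%N ->
  T^(m) P = T^(m') P' -> P = P'.
Proof.
wlog mm : m m' P P' / (m <= m')%N.
  move=> W PX P'X yX aP aP' mP mP' e.
  case: (leqP m m') => [|/ltnW] mm'; first exact: (W m m').
  by apply/esym/(W m' m).
move=> PX P'X yX aP aP' mP mP' e.
have eP : P = T^(m' - m) P'.
  have TX := iter_iet_in p hlam (m' - m) P'X.
  apply: (@iter_iet_inj _ _ lam p hlam m _ _ PX TX).
  by rewrite e -iterD subnKC.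
have [_ _ h] := ret_timeP n P'X yX.
case: (posnP (m' - m)%N) => [d0|d0]; first by rewrite eP d0.
by case: (h (m' - m)%N); rewrite -?eP// d0/= (leq_ltn_trans (leq_subr _ _) mP').
Qed.

Variables z1 z2 : R.
Hypothesis f_jump : forall u v, u < v -> f u <> f v -> u < z1 <= v \/ u < z2 <= v.

(** [P] is the point of the cylinder from which [z] is reached before the
    return; it is unique by [entry_unique]. *)
Definition entry_of n y z P := [/\ 0 <= P < 1, agree n y P &
  exists2 m, (m < ret_time n y P)%N & T^(m) P = z].

(** Between two points of one cylinder of order [(K + 1) * n], the value of [f]
    at time [i] can only change if [z1] or [z2] lies between the two images,
    and then its entry point lies between the two points. *)
Lemma cocycle_const n y u v P1 P2 i : (0 < n)%N -> 0 <= y < 1 -> 0 <= u < 1 ->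
  agree n y u -> u <= v -> 0 <= v < 1 -> agree (K.+1 * n) u v ->
  entry_of n y z1 P1 -> entry_of n y z2 P2 ->
  ~ (u < P1 <= v) -> ~ (u < P2 <= v) -> (i < ret_time n y u)%N ->
  f (T^(i) v) = f (T^(i) u).
Proof.
move=> n0 yX uX au; rewrite le_eqVlt => /orP[/eqP -> //|uv].
move=> vX auv [P1X aP1 [m1 m1P z1P]] [P2X aP2 [m2 m2P z2P]] nP1 nP2 iu.
have iL : (i <= K.+1 * n)%N.
  apply: leq_trans (leq_addr n i) _; apply: leq_trans (ret_index uX yX iu) _.
  by rewrite leq_mul2r leqnSn orbT.
have Tv := agree_iter hlam uX auv iL.
apply: contrapT => ne'.
have ne : f (T^(i) u) <> f (T^(i) v) by move=> e; apply: ne'.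
have nL : (n <= K.+1 * n)%N by rewrite mulSn leq_addr.
suff H z P m : 0 <= P < 1 -> agree n y P -> (m < ret_time n y P)%N -> T^(m) P = z ->
    T^(i) u < z <= T^(i) v -> u < P <= v.
  by have [||] := f_jump _ ne; [rewrite Tv; lra|move/(H _ _ _ P1X aP1 m1P z1P)|
     move/(H _ _ _ P2X aP2 m2P z2P)].
move=> PX aP mP Pz zuv.
pose x := u + (z - T^(i) u).
have xuv : u < x <= v by move: zuv; rewrite /x Tv; lra.
have [h0 h1 h2 h3] := cyl_bounds p hlam (K.+1 * n) uX.
have vh : cyl_lo (K.+1 * n) u <= v < cyl_hi (K.+1 * n) u.
  by apply/cylE.
have [xX ax] : 0 <= x < 1 /\ agree (K.+1 * n) u x.
  by apply/(cylE p hlam) => //; lra.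
have Tx : T^(i) x = z by rewrite (agree_iter hlam uX ax iL) /x; lra.
have -> // : P = x.
apply: (entry_unique PX xX yX aP _ mP (m' := i)); last by rewrite Tx.
- exact: agree_trans au (agree_le nL ax).
- by rewrite -(ret_time_agree uX xX yX n0 ax).
Qed.

Lemma ret_sum_const n y u v P1 P2 : (0 < n)%N -> 0 <= y < 1 -> 0 <= u < 1 ->
  agree n y u -> u <= v -> 0 <= v < 1 -> agree (K.+1 * n) u v ->
  entry_of n y z1 P1 -> entry_of n y z2 P2 ->
  ~ (u < P1 <= v) -> ~ (u < P2 <= v) -> ret_sum n y v = ret_sum n y u.
Proof.
move=> n0 yX uX au uv vX auv e1 e2 nP1 nP2.
rewrite /ret_sum -(ret_time_agree uX vX yX n0 auv); apply: eq_bigr => i _.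
exact: (cocycle_const n0 yX uX au uv vX auv e1 e2).
Qed.

End Cocycle.
End Returns.

(** * Elementary choices of segments *)

Section Segments.
Context {R : realFieldType}.
Implicit Types (u v x d P Q : R).

(** Two points meet the interiors of at most two of the three thirds of a
    segment. *)
Lemma avoid_two_points u v P Q : u < v -> exists u' v',
  [/\ u <= u', v' <= v, 3 * (v' - u') = v - u, ~ (u' < P < v') & ~ (u' < Q < v')].
Proof.
move=> uv.
have [a [b [ea eb]]] : exists a b, 3 * (a - u) = v - u /\ 3 * (b - a) = v - u.
  by exists (u + (v - u) / 3), (u + 2 * ((v - u) / 3)); split; field.
have [Pa|aP] := leP P a.
  have [Qb|bQ] := leP Q b.
    by exists b, v; split; try (move=> ?); lra.
  by exists a, b; split; try (move=> ?); lra.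
have [Qa|aQ] := leP Q a.
  have [Pb|bP] := leP P b.
    by exists b, v; split; try (move=> ?); lra.
  by exists a, b; split; try (move=> ?); lra.
by exists u, a; split; try (move=> ?); lra.
Qed.

Lemma half_segment l h x d : l <= x -> x < h -> 0 < d -> d < h - l ->
  exists u v, [/\ l <= u, v <= h, v - u = d / 2, x - d / 2 <= u & v <= x + d / 2].
Proof.
move=> lx xh d0 dl; have [lt|ge] := ltP (x - d / 2) l.
  by exists x, (x + d / 2); split; lra.
by exists (x - d / 2), x; split; lra.
Qed.

End Segments.

(** * The return cocycle modulo a subgroup *)

Section GoodCylinders.
Context {R : realType} {r : nat}.
Variables (lam : 'I_r -> R) (p : 'S_r).
Hypothesis hlam : iet_lengths lam.
Local Notation T := (iet lam p).
Local Notation "T^( n ) x" := (iter n T x) (at level 10, x at next level).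
Implicit Types (x y z u v d : R) (n m k j q : nat).
Local Notation agree := (agree lam p).
Local Notation cyl_lo := (cyl_lo lam p).
Local Notation cyl_hi := (cyl_hi lam p).
Local Notation cyl_len := (cyl_len lam p).
Local Notation ret_time := (ret_time lam p).

Variable K : nat.
Hypothesis K0 : (0 < K)%N.
Hypothesis hit : forall n x y, 0 <= x < 1 -> 0 <= y < 1 ->
  exists2 k, (k + n <= K * n)%N & agree n y (T^(k) x).
Hypothesis len_lo : forall n x, 0 <= x < 1 -> (0 < n)%N ->
  1 <= cyl_len n x * (K * n)%:R.
Hypothesis len_hi : forall n x, 0 <= x < 1 -> cyl_len n x * n%:R <= (2 * K)%:R.
Hypothesis return_dist : forall n j x, 0 <= x < 1 -> (0 < j <= n)%N ->
  1 <= `|T^(j) x - x| * (2 * K ^ 2 * n)%:R.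

Variable V : zmodType.
Variables (f : R -> V) (z1 z2 : R).
Hypothesis f_jump : forall u v, u < v -> f u <> f v -> u < z1 <= v \/ u < z2 <= v.
Hypothesis z1X : 0 <= z1 < 1.
Hypothesis z2X : 0 <= z2 < 1.
Local Notation ret_sum := (ret_sum lam p f).
Local Notation entry_of := (entry_of lam p).

Variable H : V -> Prop.
Hypothesis H0 : H 0.
Hypothesis H_sub : forall a b, H a -> H b -> H (a - b).

Lemma H_opp a : H a -> H (- a).
Proof. by move=> Ha; rewrite -[- a]add0r; exact: H_sub. Qed.

Lemma H_add a b : H a -> H b -> H (a + b).
Proof. by move=> Ha Hb; rewrite -[b]opprK; apply: H_sub => //; exact: H_opp. Qed.

Lemma H_addr a b : H b -> H (a + b) <-> H a.
Proof.
move=> Hb; split=> [h|h]; last exact: H_add.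
by rewrite -[a](addrK b); exact: H_sub.
Qed.

Lemma H_sum (I : Type) (s : seq I) (P : pred I) (F : I -> V) :
  (forall i, P i -> H (F i)) -> H (\sum_(i <- s | P i) F i).
Proof. by move=> h; elim/big_ind: _ => //; exact: H_add. Qed.

Variables (theta : R) (is_good : nat -> R -> Prop).
Hypothesis theta0 : 0 < theta.
(** What extremality provides, see [good_returns_period] below. Goodness of a
    cylinder is abstract here: only this property and [good_refine] matter. *)
Hypothesis good_returns : forall n y u v, (0 < n)%N -> 0 <= y < 1 ->
  is_good n y -> 0 <= u < 1 -> agree n y u -> u < v -> v <= cyl_hi (K.+1 * n) u ->
  theta * cyl_len n y <= v - u ->
  (forall i x, (i < ret_time n y u)%N -> u <= x < v -> f (T^(i) x) = f (T^(i) u)) ->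
  H (ret_sum n y u).

Section Level.
Variables (n : nat) (y : R).
Hypothesis n0 : (0 < n)%N.
Hypothesis yX : 0 <= y < 1.
Local Notation L := (K.+1 * n)%N.

Lemma nL : (n <= L)%N. Proof. by rewrite mulSn leq_addr. Qed.

Variables P1 P2 : R.
Hypothesis e1 : entry_of n y z1 P1.
Hypothesis e2 : entry_of n y z2 P2.

Lemma in_segment u v x : 0 <= u < 1 -> v <= cyl_hi L u -> u <= x < v ->
  0 <= x < 1 /\ agree L u x.
Proof.
move=> uX vh ux; have [h1 h2 h3 h4] := cyl_bounds p hlam L uX.
by apply/(cylE p hlam) => //; lra.
Qed.

(** An entry point may start the segment, since [f] is right continuous. *)
Lemma segment_const u v x : 0 <= u < 1 -> agree n y u -> v <= cyl_hi L u ->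
  u <= x < v -> ~ (u < P1 < v) -> ~ (u < P2 < v) -> ret_sum n y x = ret_sum n y u.
Proof.
move=> uX au vh uxv nP1 nP2; have [xX ax] := in_segment uX vh uxv.
apply: (ret_sum_const hlam hit f_jump n0 yX uX au _ xX ax e1 e2); first lra.
- by move=> h; apply: nP1; lra.
- by move=> h; apply: nP2; lra.
Qed.

Hypothesis good_y : is_good n y.

Lemma segment_good u v x : 0 <= u < 1 -> agree n y u -> v <= cyl_hi L u ->
  u <= x < v -> ~ (u < P1 < v) -> ~ (u < P2 < v) ->
  theta * cyl_len n y <= v - u -> H (ret_sum n y x).
Proof.
move=> uX au vh uxv nP1 nP2 big; rewrite (segment_const uX au vh uxv nP1 nP2).
apply: (good_returns n0 yX good_y uX au _ vh big); first lra.
move=> i w iq uwv; have [wX aw] := in_segment uX vh uwv.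
apply: (cocycle_const hlam hit f_jump n0 yX uX au _ wX aw e1 e2 _ _ iq); first lra.
- by move=> h; apply: nP1; lra.
- by move=> h; apply: nP2; lra.
Qed.

Hypothesis short : forall x, 0 <= x < 1 -> 4 * (theta * cyl_len n y) <= cyl_len L x.
Local Notation t := (theta * cyl_len n y).
(** The first alternative is harmless, since a cut at an end cuts nothing; the
    second one is what a change of scale provides in [no_good_cylinder]. *)
Hypothesis P1_apart : P1 = cyl_lo L P1 \/
  2 * t <= P1 - cyl_lo L P1 /\ 2 * t <= cyl_hi L P1 - P1.

Lemma threshold_gt0 : 0 < t.
Proof. by rewrite mulr_gt0// cyl_len_gt0. Qed.

Lemma cyl_inner x P : 0 <= x < 1 -> cyl_lo L x < P < cyl_hi L x ->
  cyl_lo L P = cyl_lo L x /\ cyl_hi L P = cyl_hi L x.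
Proof.
move=> xX /andP[lP Ph].
have [|PX a] := proj1 (cylE p hlam L P xX); first by rewrite ltW.
exact: (cyl_agree hlam xX PX a).
Qed.

Lemma cyl_start x : 0 <= x < 1 -> agree n y x -> [/\ 0 <= cyl_lo L x < 1,
  agree n y (cyl_lo L x) & cyl_hi L (cyl_lo L x) = cyl_hi L x].
Proof.
move=> xX ax; have [lX la] := cyl_lo_in p hlam L xX.
split => //; first exact: agree_trans ax (agree_le nL la).
by have [] := cyl_agree hlam xX lX la.
Qed.

Lemma P1_sides x : 0 <= x < 1 -> cyl_lo L x < P1 < cyl_hi L x ->
  cyl_hi L P1 = cyl_hi L x /\
  (2 * t <= P1 - cyl_lo L x /\ 2 * t <= cyl_hi L x - P1).
Proof.
move=> xX xP1; have [il ih] := cyl_inner xX xP1.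
split => //; case: P1_apart; rewrite il ?ih// => e.
by case/andP: xP1; rewrite -e ltxx.
Qed.

(** The only possible cut inside the cylinder of order [L] is [P1], and it
    leaves two long segments. *)
Lemma good_off_P2 x : 0 <= x < 1 -> agree n y x ->
  ~ (cyl_lo L x < P2 < cyl_hi L x) -> H (ret_sum n y x).
Proof.
move=> xX ax nP2; have [lX la lh] := cyl_start xX ax.
have [_ d2 d3 _] := cyl_bounds p hlam L xX.
have lenx : 4 * t <= cyl_hi L x - cyl_lo L x by exact: short.
have t0 := threshold_gt0.
case: (boolP (cyl_lo L x < P1 < cyl_hi L x)) => [xP1|/negP nP1]; last first.
  apply: (segment_good lX la _ _ nP1 nP2); first by rewrite lh.
    by rewrite d2.
  by apply: le_trans lenx; rewrite ler_peMl ?(ltW t0)// ler1n.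
have [hP1 [ap1 ap2]] := P1_sides xX xP1; case/andP: xP1 => l1 l2.
have [P1X aP1 _] := e1.
have tt : t <= 2 * t by rewrite ler_peMl ?(ltW t0)// ler1n.
have [xlt|xge] := ltP x P1.
  apply: (segment_good (v := P1) lX la).
  - by rewrite lh ltW.
  - by rewrite d2.
  - by rewrite ltxx andbF.
  - by move=> /andP[h1 h2]; apply: nP2; rewrite h1 (lt_trans h2).
  - exact: le_trans ap1.
apply: (segment_good (v := cyl_hi L x) P1X aP1).
- by rewrite hP1.
- by rewrite xge.
- by rewrite ltxx.
- by move=> /andP[h1 h2]; apply: nP2; rewrite h2 (lt_trans l1).
- exact: le_trans ap2.
Qed.

(** The segment of constancy of the cocycle around [P2] that is obtained when
    the cut at [P2] is forgotten. It is long, so that [P2] cannot be close to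
    both of its ends. *)
Lemma segment_around_P2 : cyl_lo L P2 < P2 -> exists u v,
  [/\ 0 <= u < 1 /\ agree n y u, cyl_lo L P2 <= u < P2,
      P2 < v <= cyl_hi L P2, 2 * t <= v - u &
  [/\ ~ (u < P1 < P2), ~ (P2 < P1 < v) &
    forall x, 0 <= x < 1 -> agree n y x -> ~ (u <= x < v) -> H (ret_sum n y x)]].
Proof.
move=> lP2; have [P1X aP1 _] := e1; have [P2X aP2 _] := e2.
have [_ c2 c3 _] := cyl_bounds p hlam L P2X.
have t0 := threshold_gt0.
have tt : t <= 2 * t by rewrite ler_peMl ?(ltW t0)// ler1n.
have lenP2 : 4 * t <= cyl_hi L P2 - cyl_lo L P2 by exact: short.
have [lX la lh] := cyl_start P2X aP2.
have out x : 0 <= x < 1 -> agree n y x -> ~ (cyl_lo L P2 <= x < cyl_hi L P2) ->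
    H (ret_sum n y x).
  move=> xX ax nx; apply: good_off_P2 => // xP2; apply: nx.
  have [-> ->] := cyl_inner xX xP2.
  by have [_ -> -> _] := cyl_bounds p hlam L xX.
have [[in1 ne]|triv] := EM (cyl_lo L P2 < P1 < cyl_hi L P2 /\ P1 <> P2); last first.
  exists (cyl_lo L P2), (cyl_hi L P2); split.
  - by [].
  - by rewrite lexx.
  - by rewrite c3 lexx.
  - by apply: le_trans lenP2; rewrite ler_pM2r// ler_nat.
  split=> // /andP[h1 h2]; apply: triv.
  - by split; [rewrite h1 (lt_trans h2)|move=> e; rewrite e ltxx in h2].
  - by split; [rewrite h2 (lt_trans lP2)|move=> e; rewrite e ltxx in h1].
have [hP1 [ap1 ap2]] := P1_sides P2X in1; case/andP: in1 => l1 l2.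
have [P12|P21] := ltP P1 P2.
  exists P1, (cyl_hi L P2); split.
  - by [].
  - by rewrite (ltW l1) P12.
  - by rewrite c3 lexx.
  - exact: ap2.
  split=> [||x xX ax nx].
  - by rewrite ltxx.
  - by move=> /andP[/lt_trans /(_ P12)]; rewrite ltxx.
  case: (boolP (cyl_lo L P2 <= x < cyl_hi L P2)) => [|/negP]; last exact: out.
  move=> /andP[x1 x2]; have xP1 : x < P1.
    by rewrite ltNge; apply/negP => h; apply: nx; rewrite h.
  apply: (segment_good (v := P1) lX la).
  - by rewrite lh ltW.
  - by rewrite x1.
  - by rewrite ltxx andbF.
  - by move=> /andP[_ /lt_trans /(_ P12)]; rewrite ltxx.
  - exact: le_trans ap1.
have {}P21 : P2 < P1 by rewrite lt_neqAle P21 andbT; apply/eqP => e; apply: ne.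
exists (cyl_lo L P2), P1; split.
- by [].
- by rewrite lexx.
- by rewrite P21 ltW.
- exact: ap1.
split=> [||x xX ax nx].
- by rewrite andbF.
- by rewrite ltxx andbF.
case: (boolP (cyl_lo L P2 <= x < cyl_hi L P2)) => [|/negP]; last exact: out.
move=> /andP[x1 x2]; have P1x : P1 <= x.
  by rewrite leNgt; apply/negP => h; apply: nx; rewrite x1.
apply: (segment_good (v := cyl_hi L P2) P1X aP1).
- by rewrite hP1.
- by rewrite P1x.
- by rewrite ltxx.
- by move=> /andP[/lt_trans /(_ P21)]; rewrite ltxx.
- exact: le_trans ap2.
Qed.

(** [P2] cuts the segment around it in two parts, at least one of which is
    long. *)
Lemma bad_segment :
  (forall x, 0 <= x < 1 -> agree n y x -> H (ret_sum n y x)) \/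
  exists u v, [/\ cyl_lo n y <= u < v /\ v <= cyl_hi n y, v - u < t,
    ~ H (ret_sum n y u), (forall x, u <= x < v -> ret_sum n y x = ret_sum n y u) &
    forall x, 0 <= x < 1 -> agree n y x -> ~ (u <= x < v) -> H (ret_sum n y x)].
Proof.
have [P2X aP2 _] := e2.
have [_ c2 c3 _] := cyl_bounds p hlam L P2X.
have [lP2|P2l] := ltP (cyl_lo L P2) P2; last first.
  left=> x xX ax; apply: good_off_P2 => // xP2.
  by have [e _] := cyl_inner xX xP2; move: P2l; rewrite e leNgt; case/andP: xP2 => ->.
have [j1 j2] := cyl_sub hlam yX P2X nL aP2.
have [u [v [[uX au] /andP[lu uP2] /andP[P2v vh] big [nP1u nP1v outuv]]]] :=
  segment_around_P2 lP2.
have uh : P2 <= cyl_hi L u.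
  have [|_ a] := proj1 (cylE p hlam L u P2X); first by rewrite lu (lt_trans uP2).
  by have [_ ->] := cyl_agree hlam P2X uX a; rewrite ltW.
have [nP2u nP2v] : ~ (u < P2 < P2) /\ ~ (P2 < P2 < v) by rewrite ltxx andbF.
have left_const x : u <= x < P2 -> ret_sum n y x = ret_sum n y u.
  by move=> ux; apply: (segment_const uX au uh).
have right_const x : P2 <= x < v -> ret_sum n y x = ret_sum n y P2.
  by move=> xv; apply: (segment_const P2X aP2 vh).
have left_good x : t <= P2 - u -> u <= x < P2 -> H (ret_sum n y x).
  by move=> bg ux; apply: (segment_good uX au uh ux).
have right_good x : t <= v - P2 -> P2 <= x < v -> H (ret_sum n y x).
  by move=> bg xv; apply: (segment_good P2X aP2 vh xv).
have yu : cyl_lo n y <= u by exact: le_trans lu.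
have vyh : v <= cyl_hi n y by exact: le_trans j2.
have [big1|small1] := leP t (P2 - u).
  have [h|h] := pselect (H (ret_sum n y P2)).
    left=> x xX ax; case: (boolP (u <= x < v)) => [/andP[ux xv]|/negP]; last exact: outuv.
    have [xP|xP] := ltP x P2; first by apply: left_good; rewrite ?ux.
    by rewrite right_const ?xP.
  right; exists P2, v; split => //.
  - by rewrite P2v (le_trans yu (ltW uP2)).
  - rewrite ltNge; apply/negP => big2; apply: h.
    by apply: right_good; rewrite // lexx.
  move=> x xX ax nx; case: (boolP (u <= x < v)) => [/andP[ux xv]|/negP]; last exact: outuv.
  apply: left_good; rewrite // ux ltNge; apply/negP => xP.
  by apply: nx; rewrite xP.
have big2 : t <= v - P2 by move: big small1; lra.
have [h|h] := pselect (H (ret_sum n y u)).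
  left=> x xX ax; case: (boolP (u <= x < v)) => [/andP[ux xv]|/negP]; last exact: outuv.
  have [xP|xP] := ltP x P2; first by rewrite left_const ?ux.
  by apply: right_good; rewrite ?xP.
right; exists u, P2; split => //.
- by rewrite uP2 yu (le_trans _ vyh)// ltW.
move=> x xX ax nx; case: (boolP (u <= x < v)) => [/andP[ux xv]|/negP]; last exact: outuv.
apply: right_good; rewrite // xv andbT leNgt; apply/negP => xP.
by apply: nx; rewrite ux.
Qed.

End Level.
Local Notation Kr := (K%:R : R).
Local Notation k1 := (K.+1%:R : R).

Hypothesis dense_invariant : forall S : R -> V -> Prop,
  (forall x s, 0 <= x < 1 -> S x s <-> S (T x) (s + f x)) ->
  (exists x s, 0 <= x < 1 /\ S x s) ->
  forall u v t, 0 <= u -> u < v -> v <= 1 -> exists2 x, u <= x < v & S x t.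

Variable t0 : V.
Hypothesis Ht0 : ~ H t0.

(** With a return cocycle in [H], the transfer function [g] makes the set of
    pairs [(x, s)] with [s - g x] in [H] invariant. Over the cylinder [g]
    vanishes, so this set misses the fibre coordinates outside [H]. *)
Lemma no_trivial_return n y : 0 <= y < 1 ->
  (forall x, 0 <= x < 1 -> agree n y x -> H (ret_sum n y x)) -> False.
Proof.
move=> yX triv; pose g := transfer lam p f n y.
have [h0 h1 h2 h3] := cyl_bounds p hlam n yX.
have [||x xin] := @dense_invariant (fun x s => H (s - g x)) _ _ (cyl_lo n y)
  (cyl_hi n y) t0 h0 ltac:(lra) h3.
- move=> x s xX.
  have -> : s + f x - g (T x) = (s - g x) + (f x + g x - g (T x)).
    by rewrite addrA; congr (_ - _); rewrite (addrC (f x)) addrA subrK.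
  suff Hx : H (f x + g x - g (T x)) by have [i1 i2] := H_addr (s - g x) Hx; split.
  case: (pselect (agree n y x)) => a.
    by rewrite /g (transfer_in hit f xX yX a); exact: triv.
  by rewrite /g (transfer_out hlam hit f xX yX a).
- by exists y, (g y); split => //; rewrite subrr.
have [xX ax] := proj1 (cylE p hlam n x yX) xin.
by rewrite /g (transfer0 hit f xX yX ax) subr0.
Qed.

Lemma cyl_len_gt n x c : (0 < n)%N -> 0 <= x < 1 -> c * n%:R * (Kr * k1) < 1 ->
  c < cyl_len (K.+1 * n) x.
Proof.
move=> n0 xX small; rewrite ltNge; apply/negP => lec.
have L0 : (0 < K.+1 * n)%N by rewrite muln_gt0.
have := len_lo xX L0; apply/negP; rewrite -ltNge; apply: le_lt_trans small.
have -> : (K * (K.+1 * n))%:R = n%:R * (Kr * k1) :> R by rewrite !natrM; ring.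
by rewrite -mulrA ler_wpM2r// !mulr_ge0.
Qed.

(** The order [m] at which a distance [d], too short to be seen at order [n],
    is commensurable with the cylinders. Here [w] bounds [2 * theta] times the
    length of a cylinder times its order ([threshold_scale]); the lower bound
    on [d * m] makes [d] longer than the threshold at order [m], even after
    division by 6, and [m] at least [(K + 1) * n], while the upper bound makes
    it shorter than all cylinders of order [(K + 1) * m], and than the
    distances between the points of a return path. *)
Lemma next_scale n d w : (0 < n)%N -> 0 < d -> d * n%:R < w ->
  exists m, [/\ (K.+1 * n <= m)%N, 3 * k1 * w <= d * m%:R & d * m%:R <= 4 * k1 * w].
Proof.
move=> n0 d0 dn.
have n1 : 1 <= n%:R :> R by rewrite ler1n.
have k11 : 1 <= k1 by rewrite ler1n.
have w0 : 0 < w by apply: lt_trans dn; rewrite mulr_gt0// ltr0n.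
have dw : d < w by apply: le_lt_trans dn; rewrite ler_peMr// ltW.
have wk : w <= k1 * w by rewrite ler_peMl// ltW.
have ex : exists m, 3 * k1 * w <= d * m%:R.
  exists (Num.bound (3 * k1 * w / d)).
  rewrite [leRHS]mulrC -ler_pdivrMr//; apply/ltW/archi_boundP.
  by rewrite divr_ge0 ?ltW// !mulr_gt0// ltr0n.
have [m hm mmin] := ex_minnP ex.
exists m; split => //.
  rewrite leqNgt; apply/negP => lt.
  have : d * m%:R <= d * (K.+1 * n)%:R by rewrite ler_pM2l// ler_nat ltnW.
  have : d * (K.+1 * n)%:R < k1 * w.
    by rewrite natrM mulrCA ltr_pM2l// (lt_le_trans _ k11).
  by lra.
case: m hm mmin => [|m] hm mmin; first by move: hm; rewrite mulr0; lra.
have : d * m%:R < 3 * k1 * w by rewrite ltNge; apply/negP => /mmin; rewrite ltnn.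
by have -> : m.+1%:R = m%:R + 1 :> R by [rewrite -natr1]; lra.
Qed.

Hypothesis theta1 : 20 * (Kr * k1) ^+ 2 * theta < 1.
Hypothesis theta2 : 32 * Kr ^+ 4 * k1 * theta < 1.

Lemma threshold_scale n x : 0 <= x < 1 ->
  2 * (theta * cyl_len n x) * n%:R <= 4 * Kr * theta.
Proof.
move=> xX; have := len_hi n xX; rewrite natrM => h.
have -> : 2 * (theta * cyl_len n x) * n%:R = 2 * theta * (cyl_len n x * n%:R) by ring.
have -> : 4 * Kr * theta = 2 * theta * (2 * Kr) by ring.
by rewrite ler_pM2l// mulr_gt0.
Qed.

Lemma threshold_short n y x : (0 < n)%N -> 0 <= y < 1 -> 0 <= x < 1 ->
  4 * (theta * cyl_len n y) <= cyl_len (K.+1 * n) x.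
Proof.
move=> n0 yX xX; apply/ltW/cyl_len_gt => //; apply: le_lt_trans theta1.
have K1 : 1 <= Kr by rewrite ler1n.
have k11 : 1 <= k1 by rewrite ler1n.
have kk : 1 <= Kr * k1 by exact: mulr_ege1.
have := threshold_scale n yX => h.
have h2 : 4 * (theta * cyl_len n y) * n%:R <= 8 * Kr * theta by lra.
apply: le_trans (_ : 8 * Kr * theta * (Kr * k1) <= _).
  by rewrite ler_wpM2r//; lra.
have -> : 20 * (Kr * k1) ^+ 2 * theta = 20 * (Kr * theta * (Kr * k1)) * k1 by ring.
have a0 : 0 <= Kr * theta * (Kr * k1) by rewrite !mulr_ge0// ?ltW//; lra.
apply: le_trans (_ : 20 * (Kr * theta * (Kr * k1)) <= _); first lra.
by rewrite ler_peMr// mulr_ge0.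
Qed.

Hypothesis good_refine : forall n m y, 0 <= y < 1 -> is_good n y ->
  (0 < m)%N -> (n <= m)%N ->
  exists z, [/\ 0 <= z < 1, agree n y z & is_good m z].

(** Times in a return path differ by at most [K * m], so [return_dist] bounds
    the distances from below. *)
Lemma orbit_spread m z x i k u v : 0 <= x < 1 -> 0 <= z < 1 ->
  (i < ret_time m z x)%N -> (k < ret_time m z x)%N -> i <> k ->
  (v - u) * (2 * Kr ^+ 3 * m%:R) < 1 ->
  u <= T^(i) x < v -> u <= T^(k) x < v -> False.
Proof.
move=> xX zX iq kq ik + /andP[iu iv] /andP[ku kv].
wlog lt : i k iq kq ik iu iv ku kv / (i < k)%N.
  move=> W sm; case: (ssrnat.ltngtP i k) => // lt; first exact: (W i k).
  by apply: (W k i) => // e; apply: ik.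
apply/negP; rewrite -leNgt.
have km := leq_trans (leq_addr m k) (ret_index hlam hit xX zX kq).
have jm : (0 < k - i <= K * m)%N.
  by rewrite subn_gt0 lt (leq_trans (leq_subr _ _)).
have := return_dist (iter_iet_in p hlam i xX) jm.
rewrite -iterD subnK ?(ltnW lt)// => h; apply: le_trans h _.
have -> : (2 * K ^ 2 * (K * m))%:R = 2 * Kr ^+ 3 * m%:R :> R by rewrite !natrM; ring.
rewrite ler_wpM2r ?mulr_ge0 ?exprn_ge0// ler_norml.
by move: iu iv ku kv; lra.
Qed.

(** A return path to the smaller cylinder is a concatenation of returns to the
    larger one. Exactly one of them starts in the bad segment, and modulo [H]
    it is the only one that contributes. *)
Lemma lone_visit n m y z u v x k : 0 <= y < 1 -> 0 <= z < 1 -> 0 <= x < 1 ->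
  (n <= m)%N -> agree n y z -> agree m z x -> (k < ret_time m z x)%N ->
  cyl_lo n y <= u -> v <= cyl_hi n y -> u <= T^(k) x < v ->
  (forall i, (i < ret_time m z x)%N -> i <> k -> ~ (u <= T^(i) x < v)) ->
  ~ H (ret_sum n y u) -> (forall x, u <= x < v -> ret_sum n y x = ret_sum n y u) ->
  (forall x, 0 <= x < 1 -> agree n y x -> ~ (u <= x < v) -> H (ret_sum n y x)) ->
  ~ H (ret_sum m z x).
Proof.
move=> yX zX xX nm ayz azx kq lu vh /andP[uk kv] once bad const other.
set q := ret_time m z x in kq once.
have [_ aq _] := ret_timeP hlam hit m xX zX; rewrite -/q in aq.
have qX := iter_iet_in p hlam q xX.
have ayx : agree n y x by exact: agree_trans ayz (agree_le nm azx).
have ayq : agree n y (T^(q) x) by exact: agree_trans ayz (agree_le nm aq).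
have := birkhoff_transfer lam p f n y q x.
rewrite (transfer0 hit f xX yX ayx) (transfer0 hit f qX yX ayq).
rewrite subr0 addr0 /ret_sum -/q => ->.
rewrite (bigD1 (Ordinal kq))//=.
set S := \sum_(i < q | _) _.
have HS : H S.
  apply: H_sum => i ine.
  have iX := iter_iet_in p hlam i xX.
  have [ai|ai] := pselect (agree n y (T^(i) x)); last first.
    by rewrite (transfer_out hlam hit f iX yX ai).
  rewrite (transfer_in hit f iX yX ai); apply: other => //.
  by apply: once => // e; case/eqP: ine; exact: val_inj.
have kX := iter_iet_in p hlam k xX.
have ak : agree n y (T^(k) x).
  have [|] := proj1 (cylE p hlam n (T^(k) x) yX) => //.
  by rewrite (le_trans lu) ?(lt_le_trans kv).
rewrite (transfer_in hit f kX yX ak) const ?uk// => /(H_addr _ HS).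
exact: bad.
Qed.

(** A return path at the next scale is led through the midpoint of the bad
    segment. Moved by less than half the length of this segment, the path still
    visits it, and there is room for such a move at least on one side of the
    starting point [x1]. A third of this room avoids the new entry points of
    [z1] and [z2], and is still long enough for the new cylinder. *)
Lemma isolated_bad_segment n y u v : (0 < n)%N -> 0 <= y < 1 -> is_good n y ->
  cyl_lo n y <= u -> u < v -> v <= cyl_hi n y -> v - u < theta * cyl_len n y ->
  ~ H (ret_sum n y u) -> (forall x, u <= x < v -> ret_sum n y x = ret_sum n y u) ->
  (forall x, 0 <= x < 1 -> agree n y x -> ~ (u <= x < v) -> H (ret_sum n y x)) ->
  False.
Proof.
move=> n0 yX gy lu uv vh small bad const other.
have [h0 h1 h2 h3] := cyl_bounds p hlam n yX.
pose w := 4 * Kr * theta.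
have n0' : 0 < n%:R :> R by rewrite ltr0n.
have d0 : 0 < v - u by rewrite subr_gt0.
have dn : (v - u) * n%:R < w.
  apply: lt_le_trans (threshold_scale n yX); rewrite ltr_pM2r//.
  apply: lt_le_trans small _; rewrite ler_peMl// ?ler1n// mulr_ge0 ?ltW//.
  exact: cyl_len_gt0.
have [m [nm lm hm]] := next_scale n0 d0 dn.
have nm' : (n <= m)%N by apply: leq_trans nm; rewrite mulSn leq_addr.
have m0 : (0 < m)%N by exact: leq_trans n0 nm'.
have m0' : 0 < m%:R :> R by rewrite ltr0n.
have [z [zX az gz]] := good_refine yX gy m0 nm'.
(* the midpoint x0 of the bad segment is reached from x1 at time k *)
pose x0 := (u + v) / 2.
have [x0u x0v] : x0 - (v - u) / 2 = u /\ x0 + (v - u) / 2 = v by rewrite /x0; split; field.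
have x0X : 0 <= x0 < 1.
  by move: h0 h3 lu vh d0 x0u x0v; lra.
have [x1 [k [x1X ax1 kq x1x0]]] := entry hlam hit m x0X zX.
have kL : (k <= K.+1 * m)%N.
  apply: leq_trans (leq_addr m k) _; apply: leq_trans (ret_index hlam hit x1X zX kq) _.
  by rewrite leq_mul2r leqnSn orbT.
have dlen : v - u < cyl_len (K.+1 * m) x1.
  apply: cyl_len_gt => //; apply: le_lt_trans (_ : 4 * k1 * w * (Kr * k1) < _).
    by rewrite ler_wpM2r ?mulr_ge0.
  have -> : 4 * k1 * w * (Kr * k1) = 16 * ((Kr * k1) ^+ 2 * theta) by rewrite /w; ring.
  have : 0 <= (Kr * k1) ^+ 2 * theta by rewrite mulr_ge0 ?exprn_ge0 ?mulr_ge0// ltW.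
  by move: theta1; rewrite -mulrA; move: (_ ^+ 2 * theta) => X; lra.
have spread : (v - u) * (2 * Kr ^+ 3 * m%:R) < 1.
  rewrite (mulrC _ m%:R) mulrA mulrC.
  apply: le_lt_trans (_ : 2 * Kr ^+ 3 * (4 * k1 * w) < _).
    by rewrite ler_wpM2l// !mulr_ge0// exprn_ge0.
  by apply: le_lt_trans theta2; rewrite /w; lra.
have [b1 b2 b3 b4] := cyl_bounds p hlam (K.+1 * m) x1X.
have [u' [v' [uu' vv' len' pos1 pos2]]] := half_segment b2 b3 d0 dlen.
have in_cyl x : u' <= x < v' -> [/\ 0 <= x < 1, agree (K.+1 * m) x1 x & agree m z x].
  move=> /andP[ux xv].
  have [|xX ax] := proj1 (cylE p hlam (K.+1 * m) x x1X).
    by rewrite (le_trans uu' ux) (lt_le_trans xv vv').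
  by split => //; apply: agree_trans ax1 (agree_le _ ax); rewrite mulSn leq_addr.
have bad' x : u' <= x < v' -> ~ H (ret_sum m z x).
  move=> xu'; have [xX ax azx] := in_cyl x xu'.
  have Txin : u <= T^(k) x < v.
    rewrite (agree_iter hlam x1X ax kL) x1x0.
    by move: xu' x0u x0v pos1 pos2; lra.
  have kq' : (k < ret_time m z x)%N by rewrite -(ret_time_agree hlam hit x1X xX zX m0 ax).
  apply: (lone_visit yX zX xX nm' az azx kq' lu vh Txin _ bad const other) => i iq ik Ti.
  exact: (orbit_spread xX zX iq kq' ik spread Ti Txin).
have [P1 [m1 [P1X aP1 m1P z1P]]] := entry hlam hit m z1X zX.
have [P2 [m2 [P2X aP2 m2P z2P]]] := entry hlam hit m z2X zX.
have e1 : entry_of m z z1 P1 by split => //; exists m1.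
have e2 : entry_of m z z2 P2 by split => //; exists m2.
have uv' : u' < v' by rewrite -subr_gt0 len' divr_gt0.
have [a [b [ua bv abl nP1 nP2]]] := avoid_two_points P1 P2 uv'.
have ab : a < b by rewrite -subr_gt0 -(pmulr_rgt0 _ (ltr0n _ 3)) abl subr_gt0.
have av' : u' <= a < v' by rewrite ua (lt_le_trans ab bv).
have [aX aa aza] := in_cyl a av'.
have [_ ha] := cyl_agree hlam x1X aX aa.
apply: (bad' a av').
apply: (segment_good m0 zX e1 e2 gz aX aza (v := b)) => //.
- by rewrite ha; exact: le_trans bv vv'.
- by rewrite lexx.
rewrite -(ler_pM2r m0').
have tm := threshold_scale m zX; rewrite -/w in tm.
have wk : w <= k1 * w by rewrite ler_peMl ?ler1n// /w !mulr_ge0// ltW.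
have -> : (b - a) * m%:R = (v - u) * m%:R / 6.
  by rewrite (_ : b - a = (v - u) / 6); [ring|move: abl len'; lra].
by move: tm wk lm; lra.
Qed.

(** The path from the smaller cylinder to [a] has its last visit to the larger
    cylinder at [P]. *)
Lemma entry_lift n m y z a P P' : 0 <= y < 1 -> 0 <= z < 1 -> (n <= m)%N ->
  agree n y z -> entry_of n y a P -> entry_of m z a P' ->
  exists2 k, (k + m <= K * m)%N & T^(k) P' = P.
Proof.
move=> yX zX nm ayz [PX aP [i iP Pa]] [P'X aP' [j jP P'a]].
have jm := ret_index hlam hit P'X zX jP.
have ij : (i <= j)%N.
  rewrite leqNgt; apply/negP => ji.
  have iX := iter_iet_in p hlam (i - j) PX.
  have e : P' = T^(i - j) P.
    apply: (@iter_iet_inj _ _ lam p hlam j _ _ P'X iX).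
    by rewrite P'a -Pa -iterD subnKC// ltnW.
  have [_ _ h] := ret_timeP hlam hit n PX yX.
  apply: (h (i - j)%N); first by rewrite subn_gt0 ji (leq_ltn_trans (leq_subr _ _) iP).
  by rewrite -e; exact: agree_trans ayz (agree_le nm aP').
exists (j - i)%N; first by apply: leq_trans jm; rewrite leq_add2r leq_subr.
have jX := iter_iet_in p hlam (j - i) P'X.
apply: (@iter_iet_inj _ _ lam p hlam i _ _ jX PX).
by rewrite Pa -P'a -iterD subnKC.
Qed.

(** [T^k] translates the cylinder of [z], so an earlier start of this cylinder
    would give an earlier start to the cylinder of [T^k z]. *)
Lemma cyl_lo_pullback k n m z : 0 <= z < 1 -> (k + n <= m)%N ->
  cyl_lo n (T^(k) z) = T^(k) z -> cyl_lo m z = z.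
Proof.
move=> zX knm e; have := cyl_orbit_lo p hlam zX knm; rewrite e.
by have [_ h _ _] := cyl_bounds p hlam m zX; lra.
Qed.

(** Let [u] be the end of the cylinder at distance [d] from [T^k P]. Pulled
    back by [T^k] it starts a cylinder of order [m], of length more than
    [d + s]. If the cylinder of [P] started closer to [P] than [s], its left
    end would be mapped by [T^k] to the right of [u] at distance at most [d],
    so it would be interior to the cylinder pulled back from [u]. On the right,
    there is room because the cylinder of [P] cannot extend to the left beyond
    distance [d]. *)
Lemma left_anchor k n m P d s : 0 <= P < 1 -> (k + n <= m)%N ->
  T^(k) P - cyl_lo n (T^(k) P) = d -> 0 < d -> s <= d ->
  (forall x, 0 <= x < 1 -> d + s < cyl_len m x) ->
  s <= P - cyl_lo m P /\ s <= cyl_hi m P - P.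
Proof.
move=> PX knm ed d0 sd len.
have kX := iter_iet_in p hlam k PX.
have km : (k <= m)%N by exact: leq_trans (leq_addr n k) knm.
have [b1 b2 b3 b4] := cyl_bounds p hlam m PX.
have lenP := len P PX; rewrite /cyl_len in lenP.
have := cyl_orbit_lo p hlam PX knm => lo.
split; last by lra.
rewrite leNgt; apply/negP => small.
have [uX _] := cyl_lo_in p hlam n kX.
have ulo := cyl_lo_lo p hlam n kX.
set u := cyl_lo n (T^(k) P) in uX ulo ed lo.
have [z zX zu] := iter_iet_surj p hlam k uX.
have zlo : cyl_lo m z = z by apply: (cyl_lo_pullback zX knm); rewrite zu.
have lenz := len z zX; rewrite /cyl_len zlo in lenz.
have [cX ac] := cyl_lo_in p hlam m PX.
have Tc := agree_iter hlam PX ac km.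
pose a := T^(k) (cyl_lo m P) - u.
have [a0 ad] : 0 < a /\ a <= d by rewrite /a Tc; lra.
have [|zaX aza] := proj1 (cylE p hlam m (z + a) zX); first lra.
have Tza := agree_iter hlam zX aza km; rewrite zu in Tza.
have e : z + a = cyl_lo m P.
  by apply: (@iter_iet_inj _ _ lam p hlam k _ _ zaX cX); rewrite Tza /a; lra.
have [e1 _] := cyl_agree hlam zX zaX aza.
by move: e1; rewrite e cyl_lo_lo// zlo; lra.
Qed.

(** The mirror image of [left_anchor]. Cylinders being closed on the left only,
    the right end of the cylinder of [P] is followed through the point [e] of
    the image cylinder: its preimage [z] by [T^k] is the start of a cylinder of
    order [m], for otherwise it would be in the cylinder of [P]. The cylinder
    of [z] is long enough to contain the preimage of the right end [v], which
    contradicts the fact that [v] is not in the cylinder of [e]. *)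
Lemma right_anchor k n m P d s : 0 <= P < 1 -> (k + n <= m)%N ->
  cyl_hi n (T^(k) P) - T^(k) P = d -> 0 < d -> s <= d ->
  (forall x, 0 <= x < 1 -> d + s < cyl_len m x) ->
  s <= P - cyl_lo m P /\ s <= cyl_hi m P - P.
Proof.
move=> PX knm ed d0 sd len.
have kX := iter_iet_in p hlam k PX.
have km : (k <= m)%N by exact: leq_trans (leq_addr n k) knm.
have [b1 b2 b3 b4] := cyl_bounds p hlam m PX.
have [c1 c2 c3 c4] := cyl_bounds p hlam n kX.
have lenP := len P PX; rewrite /cyl_len in lenP.
have := cyl_orbit_hi p hlam PX knm => hi.
split; first by lra.
rewrite leNgt; apply/negP => small.
set v := cyl_hi n (T^(k) P) in ed hi c3 c4.
pose e := T^(k) P + (cyl_hi m P - P).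
have [eX ae] : 0 <= e < 1 /\ agree n (T^(k) P) e.
  by apply/(cylE p hlam) => //; rewrite -/v /e; lra.
have [z zX ze] := iter_iet_surj p hlam k eX.
have [l1 l2 l3 l4] := cyl_bounds p hlam m zX.
have zlo : cyl_lo m z = z.
  apply/eqP; rewrite eq_le l2 leNgt /=; apply/negP => lz.
  pose x := Num.max (cyl_lo m z) (z - (cyl_hi m P - P)).
  have [x1 x2 x3] : [/\ cyl_lo m z <= x, z - (cyl_hi m P - P) <= x & x < z].
    by split; rewrite /x ?le_max ?gt_max ?lexx ?orbT// lz; lra.
  have [|xX ax] := proj1 (cylE p hlam m x zX); first lra.
  have Tx := agree_iter hlam zX ax km.
  pose x' := P + (cyl_hi m P - P) - (z - x).
  have [|x'X ax'] := proj1 (cylE p hlam m x' PX); first by rewrite /x'; lra.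
  have Tx' := agree_iter hlam PX ax' km.
  have ex : x = x'.
    apply: (@iter_iet_inj _ _ lam p hlam k _ _ xX x'X).
    by rewrite Tx Tx' ze /x' /e; lra.
  have aPz : agree m P z.
    by apply: agree_trans ax' _; rewrite -ex; exact: agree_sym.
  have := agree_iter hlam PX aPz km; rewrite ze /e => zh.
  have := proj2 (cylE p hlam m z PX) (conj zX aPz); lra.
have lenz := len z zX; rewrite /cyl_len zlo in lenz.
pose a := v - e.
have [a0 ad] : 0 < a /\ a < d by rewrite /a /e; lra.
have [|zaX aza] := proj1 (cylE p hlam m (z + a) zX); first lra.
have Tza := agree_iter hlam zX aza km; rewrite ze in Tza.
have Tv : T^(k) (z + a) = v by rewrite Tza /a; lra.
have vX := iter_iet_in p hlam k zaX.
have av := agree_shift knm aza; rewrite ze Tv in av; rewrite Tv in vX.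
have := proj2 (cylE p hlam n v kX) (conj vX (agree_trans ae av)).
by rewrite -/v; lra.
Qed.

(** Both outcomes of [bad_segment] are impossible. *)
Lemma apart_contradiction n y P : (0 < n)%N -> 0 <= y < 1 -> is_good n y ->
  entry_of n y z1 P ->
  (P = cyl_lo (K.+1 * n) P \/
   2 * (theta * cyl_len n y) <= P - cyl_lo (K.+1 * n) P /\
   2 * (theta * cyl_len n y) <= cyl_hi (K.+1 * n) P - P) -> False.
Proof.
move=> n0 yX gy e1 apart.
have [P2 [m2 [P2X aP2 m2P z2P]]] := entry hlam hit n z2X yX.
have e2 : entry_of n y z2 P2 by split => //; exists m2.
have short x : 0 <= x < 1 -> 4 * (theta * cyl_len n y) <= cyl_len (K.+1 * n) x.
  exact: (threshold_short n0 yX).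
have [triv|] := bad_segment n0 yX e1 e2 gy short apart.
  exact: (no_trivial_return yX triv).
move=> [u [v [[/andP[lu uv] vh] small bad const other]]].
exact: (isolated_bad_segment n0 yX gy lu uv vh small bad const other).
Qed.

(** If the entry point of [z1] is close to an end without being one, its
    distance [d] to this end fixes the order [m] at which [left_anchor] or
    [right_anchor] applies to its lift. *)
Lemma no_good_cylinder n y : (0 < n)%N -> 0 <= y < 1 -> is_good n y -> False.
Proof.
move=> n0 yX gy.
have [P1 [m1 [P1X aP1 m1P z1P]]] := entry hlam hit n z1X yX.
have e1 : entry_of n y z1 P1 by split => //; exists m1.
set L := (K.+1 * n)%N; set s := 2 * (theta * cyl_len n y).
case: (pselect (P1 = cyl_lo L P1 \/ s <= P1 - cyl_lo L P1 /\ s <= cyl_hi L P1 - P1)).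
  exact: (apart_contradiction n0 yX gy e1).
move=> close.
have [b1 b2 b3 b4] := cyl_bounds p hlam L P1X.
have [d [d0 ds dP]] : exists d, [/\ 0 < d, d < s &
    P1 - cyl_lo L P1 = d \/ cyl_hi L P1 - P1 = d].
  have ne : cyl_lo L P1 < P1.
    by rewrite lt_neqAle b2 andbT; apply/eqP => e; apply: close; left.
  have [lt1|ge1] := ltP (P1 - cyl_lo L P1) s.
    by exists (P1 - cyl_lo L P1); split; [lra|lra|left].
  have [lt2|ge2] := ltP (cyl_hi L P1 - P1) s.
    by exists (cyl_hi L P1 - P1); split; [lra|lra|right].
  by case: close; right.
pose w := 4 * Kr * theta.
have dn : d * n%:R < w.
  by apply: lt_le_trans (threshold_scale n yX); rewrite ltr_pM2r// ltr0n.
have [m [nm lm hm]] := next_scale n0 d0 dn.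
have nm' : (n <= m)%N by apply: leq_trans nm; rewrite mulSn leq_addr.
have m0 : (0 < m)%N by exact: leq_trans n0 nm'.
have m0' : 0 < m%:R :> R by rewrite ltr0n.
have [z [zX az gz]] := good_refine yX gy m0 nm'.
have [P1' [m1' [P1'X aP1' m1P' z1P']]] := entry hlam hit m z1X zX.
have e1' : entry_of m z z1 P1' by split => //; exists m1'.
apply: (apart_contradiction m0 zX gz e1'); right.
have [k km kP] := entry_lift yX zX nm' az e1 e1'.
have kL : (k + L <= K.+1 * m)%N.
  apply: leq_trans (_ : k + m <= _)%N; first by rewrite leq_add2l.
  by apply: leq_trans km _; rewrite leq_mul2r leqnSn orbT.
have K1 : 1 <= Kr by rewrite ler1n.
have k11 : 1 <= k1 by rewrite ler1n.
have w0 : 0 < w by rewrite /w !mulr_gt0//; lra.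
have wk : w <= k1 * w by rewrite ler_peMl// ltW.
set s' := 2 * (theta * cyl_len m z).
have sm : s' * m%:R <= w by exact: (threshold_scale m zX).
have sd : s' <= d by rewrite -(ler_pM2r m0'); lra.
have len x : 0 <= x < 1 -> d + s' < cyl_len (K.+1 * m) x.
  move=> xX; apply: (cyl_len_gt m0 xX).
  apply: le_lt_trans (_ : 5 * k1 * w * (Kr * k1) < _).
    by rewrite ler_wpM2r ?mulr_ge0// mulrDl; lra.
  by have -> : 5 * k1 * w * (Kr * k1) = 20 * (Kr * k1) ^+ 2 * theta by rewrite /w; ring.
case: dP; rewrite -kP => dP.
- exact: (left_anchor P1'X kL dP d0 sd len).
- exact: (right_anchor P1'X kL dP d0 sd len).
Qed.

End GoodCylinders.

(** * Extremal vectors and their periods *)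

(** [m] maximises the norm on the closure of [E], a compact subset of a cube;
    being in the closure, it is nearly a vector of [E]. This is expressed by a
    scalar product, because the scalar products of [m] with vectors of masses
    are additive in the interval. *)
Lemma maximal_vector (R : realType) (I : finType) (E : set (I -> R)) :
  (E !=set0)%classic -> (forall v, E v -> forall i, 0 <= v i <= 1) ->
  exists m : I -> R, (forall v, E v -> \sum_i v i ^+ 2 <= \sum_i m i ^+ 2) /\
    (forall e, 0 < e -> exists2 v, E v & \sum_i m i ^+ 2 - e < \sum_i m i * v i).
Proof.
move=> [v0 Ev0] bnd.
pose row (v : I -> R) : 'rV[R]_#|I| := \row_i v (enum_val i).
have rowE v i : row v ord0 (enum_rank i) = v i by rewrite mxE enum_rankK.
pose A : set 'rV[R]_#|I| := closure [set row v | v in E]%classic.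
have csum (g : I -> R -> R) : (forall i, continuous (g i)) ->
    continuous (fun u : 'rV[R]_#|I| => \sum_i g i (u ord0 (enum_rank i))).
  move=> cg; apply: continuous_big => [|i _ u]; first exact: add_continuous.
  apply: (@continuous_comp _ _ _ (fun u : 'rV[R]_#|I| => u ord0 (enum_rank i)) (g i)).
    exact: coord_continuous.
  exact: cg.
have cube : compact [set u : 'rV[R]_#|I| | forall i, u ord0 i \in `[0, 1]].
  by apply: (@rV_compact _ _ (fun=> `[(0 : R), 1]%classic)) => _; exact: segment_compact.
have cA : compact A.
  apply: (subclosed_compact _ cube); first exact: closed_closure.
  have /closure_id -> := compact_closed (@norm_hausdorff _ _) cube.
  by apply: closure_subset => _ [v Ev <-] i; rewrite mxE in_itv/= bnd.
have A0 : (A !=set0)%classic by exists (row v0); apply: subset_closure; exists v0.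
have csq : continuous (fun u : 'rV[R]_#|I| => \sum_i (u ord0 (enum_rank i)) ^+ 2).
  by apply: (csum (fun _ x => x ^+ 2)) => _; exact: exprn_continuous.
have [c cA' cmax] := EVT_max_rV A0 cA (continuous_subspaceT csq).
rewrite inE in cA'.
exists (fun i => c ord0 (enum_rank i)); split.
  move=> v Ev; have Av : row v \in A by rewrite inE; apply: subset_closure; exists v.
  by have := cmax _ Av; under eq_bigr do rewrite rowE.
move=> e e0.
have clin : continuous (fun u : 'rV[R]_#|I| =>
    \sum_i c ord0 (enum_rank i) * u ord0 (enum_rank i)).
  by apply: (csum (fun i x => c ord0 (enum_rank i) * x)) => i; exact: mulrl_continuous.
set S := \sum_i _ ^+ 2.
have SE : S - e < \sum_i c ord0 (enum_rank i) * c ord0 (enum_rank i).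
  rewrite (_ : \sum_i _ = S); first by rewrite ltrBlDr ltrDl.
  by apply: eq_bigr => i _; rewrite expr2.
have [_ [[v Ev <-] /= lt]] := cA' _ (cvgr_gt _ (clin c) _ SE).
by exists v => //; move: lt; under eq_bigr do rewrite rowE.
Qed.

Lemma sum_sqr_dist (R : comPzRingType) (I : finType) (g m : I -> R) :
  \sum_i (g i - m i) ^+ 2 =
  \sum_i m i ^+ 2 - 2 * (\sum_i m i * g i) + \sum_i g i ^+ 2.
Proof. by rewrite mulr_sumr -sumrB -big_split/=; apply: eq_bigr => i _; ring. Qed.

Lemma sum_sqr_eq0 (R : realDomainType) (I : finType) (g : I -> R) :
  \sum_i g i ^+ 2 <= 0 -> forall i, g i = 0.
Proof.
move=> le0 i.
have /psumr_eq0P z j : true -> 0 <= g j ^+ 2 by rewrite sqr_ge0.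
have /(_ i isT)/eqP : forall j, true -> g j ^+ 2 = 0.
  by apply: z; apply/eqP; rewrite eq_le le0 sumr_ge0// => j _; exact: sqr_ge0.
by rewrite sqrf_eq0 => /eqP.
Qed.

(** The uniform vector is the point of the hyperplane of sum 1 closest to the
    origin. *)
Lemma uniform_vector (R : realFieldType) (I : finType) (g : I -> R) :
  (0 < #|I|)%N -> \sum_i g i = 1 -> \sum_i g i ^+ 2 <= #|I|%:R^-1 ->
  forall i, g i = #|I|%:R^-1.
Proof.
move=> I0 g1 g2 i; apply/eqP; rewrite -subr_eq0; apply/eqP.
apply: (sum_sqr_eq0 (g := fun i => g i - #|I|%:R^-1)).
rewrite sum_sqr_dist -mulr_sumr g1 sumr_const.
rewrite -[X in X - _]mulr_natr expr2 -mulrA mulVf ?pnatr_eq0 -?lt0n//.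
by lra.
Qed.

Section Periods.
Context {R : realFieldType} {V : finZmodType}.
Variable m : V -> R.

Definition period (t : V) : Prop := forall s, m (s + t) = m s.

Lemma period0 : period 0. Proof. by move=> s; rewrite addr0. Qed.

Lemma periodB t u : period t -> period u -> period (t - u).
Proof. by move=> pt pu s; rewrite addrA -(pu (s + t - u)) subrK pt. Qed.

(** There are finitely many translations, so those that almost preserve [m]
    preserve it. *)
Lemma period_gap : exists2 gap, 0 < gap &
  forall t, \sum_s (m (s + t) - m s) ^+ 2 < gap -> period t.
Proof.
pose D t := \sum_s (m (s + t) - m s) ^+ 2.
have D0 t : ~ period t -> 0 < D t.
  move=> nt; rewrite ltNge; apply/negP => Dt; apply: nt => s.
  by apply/eqP; rewrite -subr_eq0; apply/eqP; exact: (sum_sqr_eq0 Dt s).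
pose h t := if `[< period t >] then 1 else D t.
exists (\big[Num.min/1]_t h t).
  by apply/bigmin_gtP; split => // t _; rewrite /h; case: asboolP => // ?; exact: D0.
move=> t Dt; apply: contrapT => nt; move: Dt; rewrite ltNge => /negP; apply.
apply: le_trans (_ : h t <= _); first exact: bigmin_le_cond.
by rewrite /h; case: asboolP.
Qed.

(** If all translations were periods, [m] would be constant, and as a limit of
    vectors of sum 1 it would be the uniform vector. *)
Lemma exists_nonperiod : #|V|%:R^-1 < \sum_i m i ^+ 2 ->
  (forall e, 0 < e -> exists2 g : V -> R, \sum_i g i = 1 &
     \sum_i m i ^+ 2 - e < \sum_i m i * g i) ->
  exists t, ~ period t.
Proof.
move=> big near; apply: contrapT => /forallNP all.
have N0 : 0 < #|V|%:R :> R by rewrite ltr0n; apply/card_gt0P; exists 0.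
have cst t : m t = m 0 by rewrite -[t]add0r; have /contrapT -> := all t.
set S := \sum_i _ in big near; set c := m 0 in cst.
have SE : S = #|V|%:R * c ^+ 2.
  by rewrite /S; under eq_bigr do rewrite cst; rewrite sumr_const -[LHS]mulr_natl.
have Sc : S <= c.
  apply/ler_addgt0Pr => e e0; have [g g1] := near e e0.
  under [ltRHS]eq_bigr do rewrite cst.
  by rewrite -mulr_sumr g1 mulr1; lra.
have S0 : 0 < S by apply: lt_trans big; rewrite invr_gt0.
have c0 : 0 < c by exact: lt_le_trans Sc.
have Nc : #|V|%:R * c <= 1 by rewrite -(ler_pM2r c0) mul1r -mulrA -expr2 -SE.
have : c <= #|V|%:R^-1 by rewrite -[leRHS]mul1r ler_pdivlMr// mulrC.
by lra.
Qed.

End Periods.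

(** * Equidistribution over the fibres *)

Section Equidistribution.
Context {R : realType} {r : nat}.
Variables (lam : 'I_r -> R) (p : 'S_r).
Hypothesis hlam : iet_lengths lam.
Local Notation T := (iet lam p).
Local Notation "T^( n ) x" := (iter n T x) (at level 10, x at next level).
Implicit Types (x y z u v d : R) (n m k j q : nat).
Local Notation agree := (agree lam p).
Local Notation cyl_lo := (cyl_lo lam p).
Local Notation cyl_hi := (cyl_hi lam p).
Local Notation cyl_len := (cyl_len lam p).
Local Notation ret_time := (ret_time lam p).

Variable K : nat.
Hypothesis K0 : (0 < K)%N.
Hypothesis hit : forall n x y, 0 <= x < 1 -> 0 <= y < 1 ->
  exists2 k, (k + n <= K * n)%N & agree n y (T^(k) x).
Hypothesis len_lo : forall n x, 0 <= x < 1 -> (0 < n)%N ->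
  1 <= cyl_len n x * (K * n)%:R.
Hypothesis len_hi : forall n x, 0 <= x < 1 -> cyl_len n x * n%:R <= (2 * K)%:R.
Hypothesis return_dist : forall n j x, 0 <= x < 1 -> (0 < j <= n)%N ->
  1 <= `|T^(j) x - x| * (2 * K ^ 2 * n)%:R.

Variable V : finZmodType.
Variables (f : R -> V) (z1 z2 : R).
Hypothesis f_jump : forall u v, u < v -> f u <> f v -> u < z1 <= v \/ u < z2 <= v.
Hypothesis z1X : 0 <= z1 < 1.
Hypothesis z2X : 0 <= z2 < 1.
Local Notation ret_sum := (ret_sum lam p f).
Local Notation birkhoff := (birkhoff lam p f).
Local Notation Kr := (K%:R : R).
Local Notation k1 := (K.+1%:R : R).

Hypothesis dense_invariant : forall S : R -> V -> Prop,
  (forall x s, 0 <= x < 1 -> S x s <-> S (T x) (s + f x)) ->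
  (exists x s, 0 <= x < 1 /\ S x s) ->
  forall u v t, 0 <= u -> u < v -> v <= 1 -> exists2 x, u <= x < v & S x t.

(** [M s a b] stands for the mass of [a, b[ in the fibre coordinate [s]. *)
Variable M : V -> R -> R -> R.
Hypothesis M_ge0 : forall s a b, 0 <= a -> a <= b -> b <= 1 -> 0 <= M s a b.
Hypothesis M_add : forall s, interval_additive (M s).
Hypothesis M_sum : forall a b, 0 <= a -> a <= b -> b <= 1 -> \sum_s M s a b = b - a.
Hypothesis M_step : forall s a b, 0 <= a < 1 -> a <= b -> b <= cyl_hi 1 a ->
  (forall x, a <= x < b -> f x = f a) ->
  M (s + f a) (T a) (T a + (b - a)) = M s a b.

(** Invariance, iterated along a segment that is moved rigidly and on which the
    values of [f] are constant at each time. *)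
Lemma M_transport k s u v : 0 <= u < 1 -> u <= v -> v <= cyl_hi k u ->
  (forall i x, (i < k)%N -> u <= x < v -> f (T^(i) x) = f (T^(i) u)) ->
  M (s + birkhoff k u) (T^(k) u) (T^(k) u + (v - u)) = M s u v.
Proof.
move=> uX uv; elim: k => [|k IH] vh const.
  by rewrite /birkhoff big_ord0 addr0 /= addrC subrK.
have [l1 h1] := cyl_sub hlam uX uX (leqnSn k) (@agree_refl _ _ lam p k u).
rewrite -IH; last 2 first.
- by lra.
- by move=> i x ik; apply: const; exact: ltnW.
have kX := iter_iet_in p hlam k uX.
have k1k : (k + 1 <= k.+1)%N by rewrite addn1.
have hi := cyl_orbit_hi p hlam uX k1k.
have ab : T^(k) u <= T^(k) u + (v - u) by lra.
have bh : T^(k) u + (v - u) <= cyl_hi 1 (T^(k) u) by lra.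
rewrite -(M_step (s + birkhoff k u) kX ab bh).
  rewrite /birkhoff big_ord_recr/= -/(birkhoff k u) addrA.
  by congr (M _ _ _); lra.
move=> x xin.
pose x' := u + (x - T^(k) u).
have x'uv : u <= x' < v by rewrite /x'; lra.
have [b1 b2 b3 b4] := cyl_bounds p hlam k uX.
have [|x'X ax'] := proj1 (cylE p hlam k x' uX); first lra.
have <- : T^(k) x' = x by rewrite (agree_iter hlam uX ax' (leqnn k)) /x'; lra.
exact: const.
Qed.

Definition avg u v (s : V) : R := M s u v / (v - u).

Definition averages : set (V -> R) := [set g | exists u v,
  [/\ 0 <= u, u < v, v <= 1 & g = avg u v]]%classic.

Lemma averages_sum g : averages g -> \sum_s g s = 1.
Proof.
move=> [a [b [a0 ab b1 ->]]]; rewrite -mulr_suml M_sum// ?ltW//.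
by rewrite divff// subr_eq0 gt_eqF.
Qed.

Lemma averages_bounds g : averages g -> forall s, 0 <= g s <= 1.
Proof.
move=> Eg s; have g0 s' : 0 <= g s'.
  case: Eg => [a [b [a0 ab b1 ->]]]; apply: divr_ge0; last by rewrite subr_ge0 ltW.
  by apply: M_ge0 => //; exact: ltW.
rewrite g0 -(averages_sum Eg) (bigD1 s)//= lerDl; exact: sumr_ge0.
Qed.

Section Maximal.
Variable m : V -> R.
Local Notation S := (\sum_i m i ^+ 2).
Hypothesis m_max : forall g, averages g -> \sum_i g i ^+ 2 <= S.

(** The interval function to which [good] is applied: its densities are the
    scalar products of the averages with [m], which never exceed the square of
    the norm of [m] ([weight_le]). *)
Definition weight u v : R := \sum_s m s * M s u v.

Lemma weight_add : interval_additive weight.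
Proof.
move=> u v w u0 uv vw w1; rewrite /weight -big_split/=; apply: eq_bigr => t _.
by rewrite (M_add t u0 uv vw w1) mulrDr.
Qed.

Lemma weightE u v : u < v -> weight u v = (\sum_s m s * avg u v s) * (v - u).
Proof.
move=> uv; rewrite mulr_suml; apply: eq_bigr => t _.
by rewrite -mulrA divfK// subr_eq0 gt_eqF.
Qed.

Lemma avg_sqr u v : 0 <= u -> u < v -> v <= 1 -> \sum_s avg u v s ^+ 2 <= S.
Proof. by move=> u0 uv v1; apply: m_max; exists u, v. Qed.

Lemma weight_le u v : 0 <= u -> u <= v -> v <= 1 -> weight u v <= S * (v - u).
Proof.
move=> u0; rewrite le_eqVlt => /orP[/eqP uv|uv] v1.
  rewrite uv subrr mulr0; rewrite uv in u0.
  by have := weight_add u0 (lexx v) (lexx v) v1; lra.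
rewrite weightE// ler_pM2r ?subr_gt0//.
have gS := avg_sqr u0 uv v1.
have : 0 <= \sum_s (avg u v s - m s) ^+ 2 by apply: sumr_ge0 => *; exact: sqr_ge0.
by rewrite sum_sqr_dist; lra.
Qed.

(** [e] is the defect of density allowed for a good cylinder. On a segment of
    relative length [theta] this defect is multiplied by [1 / theta], and must
    remain a small part of [gap]. *)
Variables (gap theta e : R).
Hypothesis gap_period : forall t, \sum_s (m (s + t) - m s) ^+ 2 < gap -> period m t.
Hypothesis gap0 : 0 < gap.
Hypothesis theta0 : 0 < theta.
Hypothesis e0 : 0 < e.
Hypothesis e_gap : 16 * e <= gap * theta.

(** In [|avg - m|^2 = |m|^2 - 2 <m, avg> + |avg|^2] the last term is at most
    [|m|^2], and the scalar product is almost [|m|^2] by [good_density]. *)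
Lemma avg_near n y u v : 0 <= y < 1 -> good lam p weight (S - e) n y ->
  cyl_lo n y <= u -> u < v -> v <= cyl_hi n y -> theta * cyl_len n y <= v - u ->
  \sum_s (avg u v s - m s) ^+ 2 <= gap / 8.
Proof.
move=> yX gy lu uv vh big.
have [b1 b2 b3 b4] := cyl_bounds p hlam n yX.
have u0 := le_trans b1 lu; have v1 := le_trans vh b4.
have lenle : e * cyl_len n y <= gap / 16 * (v - u).
  rewrite -(ler_pM2l theta0) mulrCA.
  apply: le_trans (_ : e * (v - u) <= _); first by rewrite ler_pM2l.
  by rewrite mulrA ler_pM2r ?subr_gt0//; move: e_gap; lra.
have := good_density hlam weight_add weight_le yX gy lu (ltW uv) vh.
rewrite weightE// => dens.
have gS := avg_sqr u0 uv v1.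
have vu0 : 0 < v - u by rewrite subr_gt0.
have : S - gap / 16 <= \sum_s m s * avg u v s.
  by rewrite -(ler_pM2r vu0) mulrBl; move: dens lenle; lra.
by rewrite sum_sqr_dist; move: gS; lra.
Qed.

(** With [b] the sum of [f] along the return, the average over the returned
    segment is the one over the initial segment translated by [b], and both are
    close to [m]; so [m] is close to its translate by [b], hence equal to it.
    *)
Lemma good_returns_period n y u v : (0 < n)%N -> 0 <= y < 1 ->
  good lam p weight (S - e) n y -> 0 <= u < 1 -> agree n y u -> u < v ->
  v <= cyl_hi (K.+1 * n) u -> theta * cyl_len n y <= v - u ->
  (forall i x, (i < ret_time n y u)%N -> u <= x < v -> f (T^(i) x) = f (T^(i) u)) ->
  period m (ret_sum n y u).
Proof.
move=> n0 yX gy uX au uv vh big const; apply: gap_period.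
set q := ret_time n y u in const *.
rewrite /ret_sum -/q; set b := birkhoff q u.
have [qn aq _] := ret_timeP hlam hit n uX yX; rewrite -/q in qn aq.
have qX := iter_iet_in p hlam q uX.
have qL : (q + n <= K.+1 * n)%N.
  by apply: leq_trans qn _; rewrite mulSn -add1n leq_add2r.
have qL' : (q <= K.+1 * n)%N by exact: leq_trans (leq_addr n q) qL.
have nL : (n <= K.+1 * n)%N by rewrite mulSn leq_addr.
have hn := (cyl_sub hlam uX uX nL (@agree_refl _ _ lam p n u)).2.
have hq := (cyl_sub hlam uX uX qL' (@agree_refl _ _ lam p q u)).2.
have tr t : M (t + b) (T^(q) u) (T^(q) u + (v - u)) = M t u v.
  by apply: M_transport => //; [exact: ltW|exact: le_trans vh hq].
have [ul uh] := cyl_agree hlam yX uX au.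
have [ql qh] := cyl_agree hlam yX qX aq.
have N1 : \sum_s (avg u v s - m s) ^+ 2 <= gap / 8.
  apply: (avg_near yX gy _ uv _ big); first by rewrite -ul; have [] := cyl_bounds p hlam n uX.
  by rewrite -uh; exact: le_trans vh hn.
have N2 : \sum_s (avg u v s - m (s + b)) ^+ 2 <= gap / 8.
  have e' : T^(q) u + (v - u) - T^(q) u = v - u by rewrite addrC addKr.
  have := @avg_near n y (T^(q) u) (T^(q) u + (v - u)) yX gy.
  rewrite e' ltrDl subr_gt0 => /(_ _ uv _ big).
  rewrite (reindex_inj (addIr b))/=.
  under eq_bigr do rewrite /avg e' tr.
  apply; first by rewrite -ql; have [] := cyl_bounds p hlam n qX.
  rewrite -qh; apply: le_trans (cyl_orbit_hi p hlam uX qL).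
  by rewrite lerD2l lerD2r.
apply: (@le_lt_trans _ _ (2 * (gap / 8) + 2 * (gap / 8))); last by move: gap0; lra.
apply: le_trans (lerD (ler_wpM2l _ N1) (ler_wpM2l _ N2)); rewrite ?ler0n//.
rewrite !mulr_sumr -big_split/=; apply: ler_sum => t _.
move: (avg u v t) (m t) (m (t + b)) => A B C.
have : 0 <= ((A - B) + (A - C)) ^+ 2 by exact: sqr_ge0.
by rewrite !expr2; lra.
Qed.

End Maximal.

(** A maximal vector of larger norm than the uniform one would have a proper
    group of periods and good cylinders, against [no_good_cylinder]. *)
Lemma equidistributed s a b : 0 <= a -> a <= b -> b <= 1 ->
  M s a b = (b - a) / #|V|%:R.
Proof.
move=> a0; rewrite le_eqVlt => /orP[/eqP <-|ab] b1.
  have [a1|a1] := leP a 1; last by move: b1; lra.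
  by have := M_add s a0 (lexx a) (lexx a) a1; rewrite subrr mul0r; lra.
have V0 : (0 < #|V|)%N by apply/card_gt0P; exists 0.
have EV : (averages !=set0)%classic.
  by exists (avg 0 1), 0, 1; split => //; rewrite ltr01.
have [m [mmax mnear]] := maximal_vector EV averages_bounds.
have Eab : averages (avg a b) by exists a, b; split.
have [S1|S1] := leP (\sum_i m i ^+ 2) (#|V|%:R^-1).
  rewrite -(uniform_vector V0 (averages_sum Eab) (le_trans (mmax _ Eab) S1) s).
  by rewrite mulrC divfK// subr_eq0 gt_eqF.
exfalso.
have [t0 Ht0] : exists t, ~ period m t.
  apply: (exists_nonperiod S1) => e e0; have [g Eg lt] := mnear e e0.
  by exists g => //; exact: averages_sum.
have [gap gap0 gapH] := period_gap m.
(* so small that the thresholds are negligible with respect to the lengths of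
   cylinders (theta1) and to the spacing of orbits (theta2) *)
pose theta : R := (200 * k1 ^+ 6)^-1.
have k10 : 0 < k1 by rewrite ltr0n.
have theta0 : 0 < theta by rewrite invr_gt0 mulr_gt0 ?ltr0n ?exprn_gt0.
have theta_lt c : c < 200 * k1 ^+ 6 -> c * theta < 1.
  move=> h; rewrite mulrC /theta ltr_pdivrMl ?mulr1; first exact: h.
  by rewrite mulr_gt0 ?ltr0n ?exprn_gt0.
have theta1 : 20 * (Kr * k1) ^+ 2 * theta < 1.
  apply: theta_lt; rewrite -!natrM -!natrX -!natrM ltr_nat.
  apply: (@leq_ltn_trans (20 * K.+1 ^ 6)%N).
    rewrite leq_mul2l/=; apply: (@leq_trans ((K.+1 * K.+1) ^ 2)%N).
      by rewrite leq_exp2r// leq_mul2r leqnSn orbT.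
    by rewrite mulnn -expnM leq_pexp2l.
  by rewrite ltn_mul2r expn_gt0.
have theta2 : 32 * Kr ^+ 4 * k1 * theta < 1.
  apply: theta_lt; rewrite -!natrX -!natrM ltr_nat.
  apply: (@leq_ltn_trans (32 * K.+1 ^ 6)%N).
    rewrite -mulnA leq_mul2l/=; apply: (@leq_trans (K.+1 ^ 4 * K.+1)%N).
      by rewrite leq_mul2r leq_exp2r// leqnSn orbT.
    by rewrite -expnSr leq_pexp2l.
  by rewrite ltn_mul2r expn_gt0.
set S := \sum_i m i ^+ 2 in S1.
have S0 : 0 < S by apply: lt_trans S1; rewrite invr_gt0 ltr0n.
pose e := Num.min (S / 2) (gap * theta / 16).
have e0 : 0 < e by rewrite lt_min !divr_gt0 ?mulr_gt0 ?ltr0n.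
have eS : 0 <= S - e <= S.
  have eS : e <= S / 2 by rewrite ge_min lexx.
  by move: eS S0 e0; lra.
have eg : 16 * e <= gap * theta by rewrite -ler_pdivlMl// mulrC ge_min lexx orbT.
have [n [y [n0 yX gy]]] : exists n y,
    [/\ (0 < n)%N, 0 <= y < 1 & good lam p (weight m) (S - e) n y].
  have [_ [u [v [u0 uv v1 ->]]] near] := mnear e e0.
  apply: (good_start hlam K0 len_lo len_hi (weight_add m) (weight_le mmax) eS u0 uv v1).
  by rewrite weightE// ltr_pM2r ?subr_gt0.
apply: (no_good_cylinder hlam K0 hit len_lo len_hi return_dist f_jump z1X z2X
  (period0 m) (@periodB _ _ m) theta0
  (is_good := good lam p (weight m) (S - e)) _ dense_invariant Ht0 theta1 theta2
  _ n0 yX gy).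
- exact: (good_returns_period mmax gapH gap0 theta0 e0 eg).
- move=> n' m' y' yX' gy' m0 nm.
  exact: (good_refine hlam K0 len_lo (weight_add m) m0 nm yX' gy').
Qed.

End Equidistribution.

(** * Measurability and masses of cylinders *)

Section MeasureTools.
Local Open Scope classical_set_scope.

(** Measures are cut in this form along the exchanged intervals, the fibres,
    and the level sets of [f]. *)
Lemma measure_finite_partition d (U : measurableType d) (R : realType)
    (mu : {measure set U -> \bar R}) (I : finType) (g : U -> I) (A : set U) :
    measurable A -> (forall i, measurable (g @^-1` [set i])) ->
  mu A = (\sum_i mu (A `&` g @^-1` [set i]))%E.
Proof.
move=> mA mg.
rewrite [X in mu X = _](_ : A = \bigcup_(i in [set: I]) (A `&` g @^-1` [set i])).
  have finI : finite_set [set: I] by exact: finite_finset.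
  rewrite (measure_fin_bigcup mu finI); first last.
  - by move=> i _; exact: measurableI.
  - by move=> i j _ _ [x [[_ /= <-] [_ /= <-]]].
  rewrite (fsbigE (index_enum I)) ?index_enum_uniq//=; last first.
    by move=> i _; rewrite mem_index_enum.
  by rewrite big_mkcond/=; apply: eq_bigr => i _; rewrite in_setT.
by apply/seteqP; split=> [x Ax|x [i _ []]//]; exists (g x).
Qed.

Lemma lebesgue_measure_translation (R : realType) (t : R) (A : set R) :
  measurable A ->
  lebesgue_measure ((fun x => x + t) @^-1` A) = lebesgue_measure A :> \bar R.
Proof.
move=> mA; apply/esym.
have mt : measurable_fun setT (fun x : measurableTypeR R => x + t : measurableTypeR R).
  exact: measurable_funD.
apply: (@lebesgue_measure_unique R
  (pushforward lebesgue_measure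
    (fun x : measurableTypeR R => x + t : measurableTypeR R))) => //= _ [[a b]] _ <-.
rewrite /pushforward/=.
have -> : (fun x : R => x + t) @^-1` `]a, b] = `]a - t, b - t].
  by apply/seteqP; split=> x /=; rewrite !in_itv/=; lra.
rewrite !lebesgue_measure_itv/= !lte_fin ltrD2r -!EFinD.
by case: ifP => // _; congr (_%:E); lra.
Qed.

End MeasureTools.

Section IetMeasurable.
Local Open Scope classical_set_scope.
Context {R : realType} {r : nat}.
Variables (lam : 'I_r -> R) (p : 'S_r).
Hypothesis hlam : iet_lengths lam.
Local Notation T := (iet lam p).

Lemma measurable_piece i : measurable (piece lam @^-1` [set i]).
Proof.
case: i => [i|].
  rewrite (_ : _ @^-1` _ = [set` iet_interval lam i]); first exact: measurable_itv.
  apply/seteqP; split=> x /=; rewrite /= iet_intervalE; first exact: piece_in.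
  by move=> h; apply: piece_some => //; rewrite iet_intervalE.
rewrite (_ : _ @^-1` _ = ~` `[0, 1[).
  by apply: measurableC; exact: measurable_itv.
apply/seteqP; split=> x /=; rewrite in_itv/=.
  by move=> xN /(pieceP hlam)[i]; rewrite xN.
by move=> /negP /(piece_outside hlam).
Qed.

Definition piece_shift (o : option 'I_r) : R :=
  if o is Some i then lower_start p lam i - upper_start lam i else 0.

Lemma iet_shift x : T x = x + piece_shift (piece lam x).
Proof.
case E : (piece lam x) => [i|]; first exact: iet_piece.
by rewrite addr0; move: E; rewrite /piece /iet => ->.
Qed.

Lemma measurable_translation (t : R) (A : set R) :
  measurable A -> measurable ((fun x : R => x + t) @^-1` A).
Proof.
move=> mA; rewrite -[_ @^-1` _]setTI.
have mt : measurable_fun setT (fun x : R => x + t) by exact: measurable_funD.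
exact: mt.
Qed.

Lemma measurable_iet : measurable_fun setT T.
Proof.
move=> _ A mA; rewrite setTI.
have -> : T @^-1` A = \bigcup_(o in [set: option 'I_r])
    (piece lam @^-1` [set o] `&` (fun x => x + piece_shift o) @^-1` A).
  apply/seteqP; split=> x /=; rewrite iet_shift.
    by move=> h; exists (piece lam x).
  by case=> o _ [<-].
apply: fin_bigcup_measurable => [|o _]; first exact: finite_finset.
by apply: measurableI; [exact: measurable_piece|exact: measurable_translation].
Qed.

Lemma measurable_iter_iet n : measurable_fun setT (iter n T).
Proof.
elim: n => [|n IH] /=; first exact: measurable_id.
by apply: (measurableT_comp measurable_iet IH).
Qed.

End IetMeasurable.

Section UnitLebesgue.
Local Open Scope classical_set_scope.
Context {R : realType}.

Definition unit_leb (A : set R) : \bar R := lebesgue_measure (A `&` `[0, 1[).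

Lemma measurable_unit_itv : measurable (`[0, 1[ : set (measurableTypeR R)).
Proof. exact: measurable_itv. Qed.

Let unit_leb_restr : {measure set (measurableTypeR R) -> \bar R} :=
  mrestr (@lebesgue_measure R) measurable_unit_itv.

HB.instance Definition _ := isMeasure.Build _ R R unit_leb
  (measure0 unit_leb_restr) (measure_ge0 unit_leb_restr)
  (@measure_semi_sigma_additive _ _ _ unit_leb_restr).

Lemma unit_lebE (a b : R) : 0 <= a -> a <= b -> b <= 1 ->
  unit_leb `[a, b[ = (b - a)%:E.
Proof.
move=> a0 ab b1; rewrite /unit_leb setIidl; last first.
  by move=> x /=; rewrite !in_itv/=; lra.
rewrite lebesgue_measure_itv/= lte_fin.
case: ltP => [_|ba]; first by rewrite EFinB.
by have -> : b = a by [lra]; rewrite subrr.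
Qed.

End UnitLebesgue.

Lemma sum_ord_const (R : realType) (a : \bar R) n : a \is a fin_num ->
  (\sum_(k < n) a = a * n%:R%:E)%E.
Proof.
by move=> /fineK <-; rewrite sumEFin sumr_const card_ord -[RHS]EFinM mulr_natr.
Qed.

Section IetMass.
Local Open Scope classical_set_scope.
Context {R : realType} {r : nat}.
Variables (lam : 'I_r -> R) (p : 'S_r).
Hypothesis hlam : iet_lengths lam.
Local Notation T := (iet lam p).
Local Notation "T^( n ) x" := (iter n T x) (at level 10, x at next level).
Implicit Types (x y : R) (n k j : nat) (A : set R).

(** Piece by piece the exchange is a translation, and its images are the pieces
    of the partition with permuted lengths. *)
Lemma unit_leb_iet A : measurable A -> unit_leb (T @^-1` A) = unit_leb A.
Proof.
move=> mA; rewrite /unit_leb.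
have mTA : measurable (T @^-1` A).
  by rewrite -[_ @^-1` _]setTI; exact: measurable_iet.
have mX := measurable_unit_itv.
rewrite (measure_finite_partition lebesgue_measure (g := piece lam)); last first.
- exact: measurable_piece.
- exact: measurableI.
rewrite [RHS](measure_finite_partition lebesgue_measure (g := piece (lam \o p))); last first.
- exact: measurable_piece (permuted_lengths p hlam).
- exact: measurableI.
rewrite [RHS](reindex_inj (h := omap (p^-1)%g)); last first.
  by move=> [i|] [j|] //= [/(@perm_inj _ (p^-1)%g) ->].
apply: eq_bigr => o _.
rewrite -[RHS](lebesgue_measure_translation (piece_shift lam p o)); last first.
  apply: measurableI; first exact: measurableI.
  exact: measurable_piece (permuted_lengths p hlam) _.
congr (lebesgue_measure _); apply/seteqP; split=> x /=; rewrite !in_itv/=.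
- move=> [[Tx xX] <-]; rewrite -iet_shift; split; first by rewrite iet_in.
  have [i xi _] := pieceP hlam xX; rewrite xi /=.
  apply: piece_some; first exact: permuted_lengths.
  exact: iet_image.
- case: o => [i|] /=; last first.
    rewrite addr0 => -[[_ xX]].
    by have [k ->] := pieceP (permuted_lengths p hlam) xX.
  move=> [[Ax xX] /piece_in]; rewrite -(lower_start_perm p lam) /= permKV => h.
  have xi : piece lam x = Some i.
    by apply: piece_some => //; rewrite iet_intervalE; lra.
  rewrite iet_shift xi; split=> //; split=> //.
  by have := piece_in xi; have := upper_start_bounds i hlam; lra.
Qed.

Variable nu : {measure set R -> \bar R}.
Hypothesis nu1 : nu `[0, 1[ = 1%E.
Hypothesis nuT : forall A, measurable A -> nu (T @^-1` A) = nu A.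

Lemma measurable_iter_preimage n (A : set R) :
  measurable A -> measurable (iter n T @^-1` A).
Proof.
by move=> mA; rewrite -[_ @^-1` _]setTI; exact: (measurable_iter_iet p hlam n).
Qed.

Lemma mass_iter n A : measurable A -> nu (iter n T @^-1` A) = nu A.
Proof.
move=> mA; elim: n => // n IH.
rewrite -IH -[in RHS]nuT; last exact: measurable_iter_preimage.
by congr (nu _); apply/seteqP; split=> x /=; rewrite -iterSr.
Qed.

Lemma iter_outside n x : ~~ (0 <= x < 1) -> T^(n) x = x.
Proof. by move=> xX; elim: n => //= n ->; exact: iet_outside. Qed.

Lemma mass_le1 A : measurable A -> A `<=` `[0, 1[ -> (nu A <= 1)%E.
Proof.
move=> mA AX; rewrite -nu1; apply: le_measure; rewrite ?inE//.
Qed.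

Variable K : nat.
Hypothesis K0 : (0 < K)%N.
Hypothesis hit : forall n x y, 0 <= x < 1 -> 0 <= y < 1 ->
  exists2 k, (k + n <= K * n)%N & agree lam p n y (T^(k) x).

Local Notation cylinder n x := (`[cyl_lo lam p n x, cyl_hi lam p n x[).

Lemma cylinder_sub n x : 0 <= x < 1 -> cylinder n x `<=` `[0, 1[.
Proof.
by move=> xX y /=; rewrite !in_itv/= => /(cylE p hlam n y xX)[].
Qed.

Lemma cyl_mass_le1 n x : 0 <= x < 1 -> (nu (cylinder n x) <= 1)%E.
Proof.
by move=> xX; apply: mass_le1; [exact: measurable_itv|exact: cylinder_sub].
Qed.

Lemma cyl_mass_fin n x : 0 <= x < 1 -> nu (cylinder n x) \is a fin_num.
Proof.
move=> xX; rewrite ge0_fin_numE//.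
exact: le_lt_trans (cyl_mass_le1 n xX) (ltry _).
Qed.

(** The first [K * n] preimages of a cylinder cover [0, 1[, by recurrence. *)
Lemma cyl_mass_lo n x : 0 <= x < 1 -> (0 < n)%N ->
  (1 <= nu (cylinder n x) * (K * n)%:R%:E)%E.
Proof.
move=> xX n0; rewrite -nu1.
apply: (@le_trans _ _ (\sum_(k < K * n) nu (iter k T @^-1` cylinder n x))%E).
- apply: (@content_subadditive _ _ _ nu _ (fun k => iter k T @^-1` cylinder n x)).
  + by move=> k _; exact: measurable_iter_preimage.
  + exact: measurable_itv.
  + move=> y; rewrite /= in_itv/= => yX.
    rewrite -(bigcup_mkord _ (fun k => iter k T @^-1` cylinder n x)).
    have [k kn a] := hit n yX xX.
    exists k => /=; first by lia.
    by rewrite in_itv/=; apply/cylE => //; split=> //; exact: iter_iet_in.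
- rewrite (eq_bigr (fun=> nu (cylinder n x))); last first.
    by move=> k _; rewrite mass_iter//; exact: measurable_itv.
  by rewrite sum_ord_const// cyl_mass_fin.
Qed.

Hypothesis aper : forall j, (0 < j)%N -> exists2 y, 0 <= y < 1 & T^(j) y <> y.

(** The first [n / K] preimages of a cylinder are disjoint, by
    [no_early_return]. The factor 2 makes up for the integer part. *)
Lemma cyl_mass_hi n x : 0 <= x < 1 ->
  (nu (cylinder n x) * n%:R%:E <= (2 * K)%:R%:E)%E.
Proof.
move=> xX; pose m := (n %/ K)%N.
have C1 := cyl_mass_le1 n xX.
have [m0|m0] := posnP m.
  have nK : (n <= 2 * K)%N.
    by move: m0 => /eqP; rewrite /m -leqn0 leqNgt divn_gt0// -ltnNge; lia.
  apply: (@le_trans _ _ (1 * n%:R%:E)%E); first by rewrite lee_wpmul2r.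
  by rewrite mul1e lee_fin ler_nat.
pose F j := if (j < m)%N then iter j T @^-1` cylinder n x else set0.
have mF j : measurable (F j).
  by rewrite /F; case: ifP => // _; exact: measurable_iter_preimage.
have tF : trivIset setT F.
  suff H i j : (i < j)%N -> F i `&` F j = set0.
    move=> i j _ _ /set0P/eqP nz; case: (ssrnat.ltngtP i j) => // ij; case: nz.
      exact: H.
    by rewrite setIC; exact: H.
  move=> ij; rewrite -subset0 /F => y; case: ifP => [im|_ []//]; case: ifP => [jm|_ []//].
  move=> [/= yi yj].
  have yX : 0 <= y < 1.
    apply/negPn/negP => yX; move: yi; rewrite (iter_outside i yX).
    by move/(cylinder_sub xX) => /=; rewrite in_itv/=; apply/negP.
  move: yi yj; rewrite !in_itv/= => /(cylE p hlam n _ xX)[_ ai] /(cylE p hlam n _ xX)[_ aj].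
  have a : agree lam p n (T^(i) y) (T^(j - i) (T^(i) y)).
    rewrite -iterD subnK; last exact: ltnW.
    exact: agree_trans (agree_sym ai) aj.
  apply: (no_early_return hlam K0 hit aper (iter_iet_in p hlam i yX) _ _ a).
    by rewrite subn_gt0.
  apply: (@leq_trans (K * m)); last by rewrite mulnC leq_trunc_div.
  by rewrite leq_mul2l; apply/orP; right; lia.
have := measure_bigsetU nu mF tF m.
rewrite (eq_bigr (fun=> nu (cylinder n x))); last first.
  by move=> k _; rewrite /F ltn_ord; apply: mass_iter; exact: measurable_itv.
rewrite sum_ord_const ?cyl_mass_fin// => E.
have : (nu (cylinder n x) * m%:R%:E <= 1)%E.
  rewrite -E; apply: mass_le1.
    by rewrite -bigcup_mkord; apply: bigcup_measurable => k _.
  rewrite -bigcup_mkord => y [k /= km]; rewrite /F km => /= yk /=; rewrite in_itv/=.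
  apply/negPn/negP => yX; move: yk; rewrite (iter_outside k yX).
  by move/(cylinder_sub xX) => /=; rewrite in_itv/=; apply/negP.
have nb : (n <= 2 * K * m)%N.
  by have := ltn_ceil n K0; rewrite -/m; have := leq_mul (leqnn K) m0; nia.
move=> h; apply: (@le_trans _ _ (nu (cylinder n x) * (2 * K * m)%:R%:E)%E).
  by rewrite lee_wpmul2l// lee_fin ler_nat.
rewrite natrM EFinM muleCA muleC -[leRHS]mul1e.
by rewrite lee_wpmul2r// lee_fin.
Qed.

End IetMass.

(** * Measures on the product *)

Section Slices.
Local Open Scope classical_set_scope.
Context {R : realType} {N : nat}.
Local Notation Z := (cyc N).
Implicit Types (A : set (R * Z)) (B : set R) (s : Z).

Definition slice s (x : R) : R * Z := (x, s).

Lemma measurable_slice s : measurable_fun setT (slice s).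
Proof. by apply: measurable_fun_pair; [exact: measurable_id|exact: measurable_cst]. Qed.

Lemma measurable_slice_preimage s A : measurable A -> measurable (slice s @^-1` A).
Proof. by move=> mA; rewrite -[_ @^-1` _]setTI; exact: measurable_slice. Qed.

Lemma measurable_fst_preimage B : measurable B -> measurable (@fst R Z @^-1` B).
Proof. by move=> mB; rewrite -[_ @^-1` _]setTI; exact: measurable_fst. Qed.

Lemma measurable_snd_preimage (C : set Z) : measurable (@snd R Z @^-1` C).
Proof. by rewrite -[_ @^-1` _]setTI; exact: measurable_snd. Qed.

Definition slice_mass (mu : {measure set (R * Z) -> \bar R}) s :
  {measure set R -> \bar R}.
Proof.
unshelve refine (pushforward (mrestr mu (measurable_snd_preimage [set s])) fst :
  {measure set R -> \bar R}).
exact: measurable_fst.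
Defined.

Lemma slice_massE mu s B :
  slice_mass mu s B = mu (@fst R Z @^-1` B `&` @snd R Z @^-1` [set s]).
Proof. by []. Qed.

Lemma measure_slices (mu : {measure set (R * Z) -> \bar R}) A : measurable A ->
  mu A = (\sum_s slice_mass mu s (slice s @^-1` A))%E.
Proof.
move=> mA; rewrite (measure_finite_partition mu (g := snd) mA); last first.
  by move=> s; exact: measurable_snd_preimage.
apply: eq_bigr => s _; rewrite slice_massE; congr (mu _).
by apply/seteqP; split=> -[x t] /= [h ts]; move: h; rewrite /slice ts.
Qed.

Definition slice_leb s : {measure set (R * Z) -> \bar R}.
Proof.
unshelve refine (pushforward (@unit_leb R) (slice s) : {measure set (R * Z) -> \bar R}).
exact: measurable_slice.
Defined.

Definition cyc_weight : {nonneg R} := (#|{: Z}|%:R^-1)%:nng.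

(** The product of Lebesgue measure on [0, 1[ by the uniform probability of the
    fibre, as a finite sum of measures. The sum runs over [inord k] since
    [msum] is indexed by natural numbers. *)
Definition uniform_mass : set (R * Z) -> \bar R :=
  msum (fun k => mscale cyc_weight (slice_leb (inord k : 'Z_N))) (Zp_trunc N).+2.

HB.instance Definition _ := Measure.on uniform_mass.

Lemma uniform_massE A :
  uniform_mass A = (\sum_s cyc_weight%:num%:E * unit_leb (slice s @^-1` A))%E.
Proof.
rewrite /uniform_mass /msum /=; apply: eq_bigr => s _.
by rewrite /mscale/= inord_val.
Qed.

Lemma unit_leb_unit B : `[0, 1[ `<=` B -> unit_leb B = 1%E.
Proof.
move=> XA; rewrite /unit_leb setIidr//.
have := @unit_lebE R 0 1 (lexx _) ler01 (lexx _).
by rewrite /unit_leb setIid subr0.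
Qed.

Lemma uniform_mass1 A : @phase_space R N `<=` A -> uniform_mass A = 1%E.
Proof.
move=> XA; rewrite uniform_massE.
rewrite (eq_bigr (fun=> cyc_weight%:num%:E)).
  rewrite sumEFin sumr_const -[X in X%:E]mulr_natr /=.
  rewrite mulVf// pnatr_eq0 -lt0n; apply/card_gt0P; exists (0 : 'Z_N) => //.
move=> s _; rewrite unit_leb_unit ?mule1// => x xX; apply: XA.
by split.
Qed.

HB.instance Definition _ := Measure_isProbability.Build _ _ R uniform_mass
  (uniform_mass1 (@subsetT _ _)).

(** Half-lines generate the Borel sets and are stable by intersection, and a
    half-line meets [0, 1[ in an interval. *)
Lemma unit_measure_unique (nu : {measure set R -> \bar R}) (c : {nonneg R}) :
  nu (~` `[0, 1[) = 0%E ->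
  (forall a b, 0 <= a -> a <= b -> b <= 1 -> nu `[a, b[ = (c%:num * (b - a))%:E) ->
  forall B, measurable B -> nu B = (c%:num%:E * unit_leb B)%E.
Proof.
move=> nu0 nuE.
have mX : measurable (`[0, 1[ : set R) by exact: measurable_itv.
have inX B : measurable B -> nu B = nu (B `&` `[0, 1[).
  move=> mB; rewrite (measureDI nu mB mX) [X in (X + _)%E](_ : _ = 0%E) ?add0e//.
  apply: subset_measure0 nu0; rewrite ?inE.
  - exact: measurableD.
  - exact: measurableC.
  - by move=> x [].
have key x : nu `[x, +oo[ = (c%:num%:E * unit_leb `[x, +oo[)%E.
  rewrite inX; last exact: measurable_itv.
  have E : `[x, +oo[ `&` `[0, 1[ = `[Num.max x 0, 1[ :> set R.
    apply/seteqP; split=> y /=; rewrite !in_itv/= ?andbT ge_max.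
      by move=> [-> /andP[-> ->]].
    by move=> /andP[/andP[-> ->] ->].
  have [x1|x1] := ltP x 1.
    have mx1 : Num.max x 0 <= 1 by rewrite ge_max ltW// ler01.
    have mx0 : 0 <= Num.max x 0 by rewrite le_max lexx orbT.
    rewrite E nuE// EFinM; congr (_ * _)%E.
    by rewrite -(unit_lebE mx0 mx1 (lexx _)) /unit_leb E setIidl// -E; exact: subIsetr.
  have E0 : `[x, +oo[ `&` `[0, 1[ = set0 :> set R.
    apply/seteqP; split=> y //=; rewrite !in_itv/= andbT => -[xy /andP[_ y1]].
    by move: x1; rewrite leNgt (le_lt_trans xy y1).
  by rewrite /unit_leb E0 !measure0 mule0.
move=> B mB.
apply: (measure_unique (@RGenCInfty.G R) (fun k => `[- k%:R, +oo[) _ _ _ _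
  nu (mscale c (@unit_leb R))) => //.
- exact: RGenCInfty.measurableE.
- move=> _ _ [x ->] [y ->]; exists (Num.max x y).
  by apply/seteqP; split=> z /=; rewrite !in_itv/= !andbT ge_max;
    [case=> -> ->|move=> /andP].
- by move=> k; exists (- k%:R).
- apply/seteqP; split=> // x _; exists (Num.bound `|x|) => //=.
  have := archi_boundP (normr_ge0 x); rewrite ltr_norml in_itv/= andbT.
  by move=> /andP[/ltW].
- by move=> _ [x ->]; exact: key.
- move=> k; rewrite inX; last exact: measurable_itv.
  apply: (@le_lt_trans _ _ (nu `[0, 1[)).
    by apply: le_measure; rewrite ?inE//; apply: measurableI => //; exact: measurable_itv.
  by rewrite nuE ?lexx ?ler01// ltry.
Qed.

End Slices.

(** * Consequences of minimality, and the product measure *)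

Section Minimality.
Local Open Scope classical_set_scope.
Context {R : realType} {r N : nat}.
Variables (lam : 'I_r -> R) (p : 'S_r) (z1 z2 : R) (a1 a2 a3 : int).
Hypothesis hlam : iet_lengths lam.
Local Notation T := (iet lam p).
Local Notation "T^( n ) x" := (iter n T x) (at level 10, x at next level).
Local Notation f := (step_fun N z1 z2 a1 a2 a3).
Local Notation F := (veech_ext (N := N) lam p z1 z2 a1 a2 a3).
Implicit Types (x y u v : R) (n k j : nat).

(** Minimality in the form used above: a nonempty set of pairs that is
    invariant in both directions contains an orbit, hence meets every open set,
    and each fibre coordinate is isolated. *)
Lemma minimal_dense : minimal F ->
  forall S : R -> 'Z_N -> Prop,
  (forall x s, 0 <= x < 1 -> S x s <-> S (T x) (s + f x)) ->
  (exists x s, 0 <= x < 1 /\ S x s) ->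
  forall u v t, 0 <= u -> u < v -> v <= 1 -> exists2 x, u <= x < v & S x t.
Proof.
move=> hmin S inv [x0 [s0 [x0X S0]]] u v t u0 uv v1.
have fwd n z : 0 <= z.1 < 1 ->
    0 <= (iter n F z).1 < 1 /\ (S z.1 z.2 <-> S (iter n F z).1 (iter n F z).2).
  elim: n z => [|n IH] z zX; first by split.
  rewrite iterS; have [nX nS] := IH z zX; split; first exact: iet_in.
  by apply: (iff_trans nS); exact: inv.
have outside n z : ~~ (0 <= z.1 < 1) -> (iter n F z).1 = z.1.
  by move=> zX; elim: n => //= n ->; exact: iet_outside.
pose m := (u + v) / 2.
have muv : u < m < v by rewrite /m; lra.
have z0X : @phase_space R N (x0, s0) by split => //=; rewrite in_itv/=.
have mX : @phase_space R N (m, t) by split => //=; rewrite in_itv/=; lra.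
have nt : nbhs (t : cyc N) [set t : cyc N] by exact: discrete_set1.
have nb : nbhs (m, t : cyc N) (`]u, v[ `*` [set t : cyc N]).
  exists (`]u, v[, [set t : cyc N]) => //=; split => //=.
  by apply: near_in_itvoo; rewrite in_itv.
have [w [[n orb] [/= wuv wt]]] := hmin _ z0X _ mX _ nb.
move: wuv; rewrite in_itv/= => wuv.
exists w.1; first lra.
rewrite -wt; case: orb => orb.
  by have [_ [h _]] := fwd n (x0, s0) x0X; rewrite orb; exact: h.
have wX : 0 <= w.1 < 1 by lra.
by have [_ [_ h]] := fwd n w wX; apply: h; rewrite -orb.
Qed.

(** If [T^j] were the identity, the fibres over the orbit of 0 would be an
    invariant set, carried by at most [j] points, which cannot meet [j + 1]
    disjoint intervals. *)
Lemma minimal_aperiodic : minimal F ->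
  forall j, (0 < j)%N -> exists2 y, 0 <= y < 1 & T^(j) y <> y.
Proof.
move=> hmin j j0; apply: contrapT => no.
have per y : 0 <= y < 1 -> T^(j) y = y.
  by move=> yX; apply: contrapT => ne; apply: no; exists y.
have X0 : 0 <= (0 : R) < 1 by rewrite lexx ltr01.
pose S x (s : 'Z_N) := exists i : 'I_j, x = T^(i) 0.
have inv x s : 0 <= x < 1 -> S x s <-> S (T x) (s + f x).
  move=> xX; split=> [[i ->]|[i e]].
    have [lt|ge] := ltnP i.+1 j; first by exists (Ordinal lt).
    exists (Ordinal j0) => /=; rewrite -iterS (_ : i.+1 = j) ?per//.
    by apply/eqP; rewrite eqn_leq ge ltn_ord.
  case: i e => [[|i] ij] /= e.
    have jj : (j.-1 < j)%N by rewrite prednK.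
    exists (Ordinal jj) => /=; apply: (iet_inj hlam (p := p)) => //; first exact: iter_iet_in.
    by rewrite e -iterS prednK// per.
  have ij' : (i < j)%N by exact: ltnW.
  exists (Ordinal ij') => /=; apply: (iet_inj hlam (p := p)) => //; exact: iter_iet_in.
have dense := minimal_dense hmin inv.
have j1 : 0 < j.+1%:R :> R by rewrite ltr0n.
have ex (k : 'I_j.+1) : exists i : 'I_j, k%:R / j.+1%:R <= T^(i) 0 < (k.+1)%:R / j.+1%:R.
  have [||||x xin [i e]] := dense _ (k%:R / j.+1%:R) (k.+1%:R / j.+1%:R) 0.
  - by exists 0, 0; split => //; exists (Ordinal j0).
  - by rewrite divr_ge0.
  - by rewrite ltr_pM2r ?invr_gt0// ltr_nat.
  - by rewrite ler_pdivrMr// mul1r ler_nat.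
  - by exists i; rewrite -e.
have [g gP] := choice ex.
have ginj : injective g.
  move=> k k' e; have := gP k; have := gP k'; rewrite e.
  move=> /andP[h1 h2] /andP[h3 h4].
  have := le_lt_trans h1 h4; have := le_lt_trans h3 h2.
  rewrite !ltr_pM2r ?invr_gt0// !ltr_nat !ltnS => l1 l2.
  by apply/val_inj/eqP; rewrite eqn_leq l1 l2.
by have := leq_card g ginj; rewrite !card_ord ltnn.
Qed.

Lemma measurable_step_fun (c : 'Z_N) : measurable (f @^-1` [set c]).
Proof.
have mf : measurable_fun setT (f : R -> cyc N).
  rewrite /step_fun.
  under eq_fun do rewrite (fun_if (fun a : int => a%:~R : 'Z_N))
    (fun_if (fun a : int => a%:~R : 'Z_N)).
  apply: measurable_fun_ifT; first exact: measurable_fun_ltr.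
    exact: measurable_cst.
  apply: measurable_fun_ifT; first exact: measurable_fun_ltr.
    exact: measurable_cst.
  exact: measurable_cst.
by rewrite -[_ @^-1` _]setTI; exact: mf.
Qed.

(** On the level set of [f] where [f = c], the extension exchanges the copies
    by adding [c] and acts as [T] on each of them. *)
Lemma uniform_mass_invariant A : measurable A ->
  uniform_mass (F @^-1` A) = @uniform_mass R N A.
Proof.
move=> mA; rewrite !uniform_massE -!ge0_sume_distrr//; congr (_ * _)%E.
have mTs (s : cyc N) : measurable (T @^-1` (slice s @^-1` A)).
  rewrite -[_ @^-1` _]setTI; apply: (measurable_iet p hlam) => //.
  exact: measurable_slice_preimage.
transitivity (\sum_(s : 'Z_N) \sum_(c : 'Z_N)
    @unit_leb R (T @^-1` (slice (s + c)%R @^-1` A) `&` f @^-1` [set c]))%E.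
  apply: eq_bigr => s _.
  have E : slice s @^-1` (F @^-1` A) =
      \bigcup_(c in [set: 'Z_N]) (T @^-1` (slice (s + c)%R @^-1` A) `&` f @^-1` [set c]).
    apply/seteqP; split=> [x h|x [c _ [/= h fc]]]; first by exists (f x).
    by move: h; rewrite -fc.
  have mE : measurable (slice s @^-1` (F @^-1` A)).
    rewrite E; apply: fin_bigcup_measurable => [|c _]; first exact: finite_finset.
    by apply: measurableI; [exact: mTs|exact: measurable_step_fun].
  rewrite (measure_finite_partition (@unit_leb R) (g := f) mE) => [|c]; last first.
    exact: measurable_step_fun.
  apply: eq_bigr => c _; congr (unit_leb _).
  by apply/seteqP; split=> x [/= h fc]; split => //; move: h; rewrite /slice /veech_ext /= fc.
rewrite exchange_big/=.
transitivity (\sum_(c : 'Z_N) \sum_(s : 'Z_N)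
    @unit_leb R (T @^-1` (slice s @^-1` A) `&` f @^-1` [set c]))%E.
  by apply: eq_bigr => c _; rewrite [RHS](reindex_inj (addIr c)).
rewrite exchange_big/=; apply: eq_bigr => s _.
rewrite -(measure_finite_partition (@unit_leb R) (g := f) (mTs s)); last first.
  by move=> c; exact: measurable_step_fun.
have := unit_leb_iet p hlam (measurable_slice_preimage s mA); exact.
Qed.

End Minimality.

(** * Invariant probabilities of the extension *)

Section InvariantMasses.
Local Open Scope classical_set_scope.
Context {R : realType} {r N : nat}.
Variables (lam : 'I_r -> R) (p : 'S_r) (z1 z2 : R) (a1 a2 a3 : int).
Hypothesis hlam : iet_lengths lam.
Local Notation T := (iet lam p).
Local Notation "T^( n ) x" := (iter n T x) (at level 10, x at next level).
Local Notation f := (step_fun N z1 z2 a1 a2 a3).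
Local Notation F := (veech_ext (N := N) lam p z1 z2 a1 a2 a3).
Local Notation cyl_lo := (cyl_lo lam p).
Local Notation cyl_hi := (cyl_hi lam p).
Local Notation cyl_len := (cyl_len lam p).
Implicit Types (x y a b : R) (n k j : nat).

Variable nu : probability (R * cyc N)%type R.
Hypothesis nu_inv : invariant_probability F nu.

Let nu1 : {measure set R -> \bar R}.
Proof.
unshelve refine (pushforward nu fst : {measure set R -> \bar R}).
exact: measurable_fst.
Defined.

Lemma base_mass_unit : nu1 `[0, 1[ = 1%E.
Proof.
case: nu_inv => <- _; rewrite /nu1 /pushforward/=; congr (nu _).
by apply/seteqP; split=> -[x s] //= [].
Qed.

Lemma base_mass_invariant A : measurable A -> nu1 (T @^-1` A) = nu1 A.
Proof.
move=> mA; case: nu_inv => _ inv.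
by rewrite -[RHS](inv _ (measurable_fst_preimage mA)).
Qed.

Lemma measure_fin_num (A : set (R * cyc N)) : measurable A -> nu A \is a fin_num.
Proof. by move=> mA; exact: fin_num_measure. Qed.

(** From left to right this is the injectivity of [T^k], which has to exclude
    also the points outside [0, 1[: they are fixed. *)
Lemma image_segment k x a b y : 0 <= x < 1 -> cyl_lo k x <= a -> b <= cyl_hi k x ->
  T^(k) x + (a - x) <= T^(k) y < T^(k) x + (b - x) <-> a <= y < b.
Proof.
move=> xX la bh; have [h0 h1 h2 h3] := cyl_bounds p hlam k xX.
split=> h; last first.
  have [|yX ay] := proj1 (cylE p hlam k y xX); first lra.
  by rewrite (agree_iter hlam xX ay (leqnn k)); lra.
pose z := x + (T^(k) y - T^(k) x).
have zab : a <= z < b by rewrite /z; lra.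
have [|zX az] := proj1 (cylE p hlam k z xX); first lra.
have Tz : T^(k) z = T^(k) y by rewrite (agree_iter hlam xX az (leqnn k)) /z; lra.
have yX : 0 <= y < 1.
  apply/negPn/negP => ny; move: (ny); rewrite -(iter_outside p hlam k ny) -Tz.
  by rewrite iter_iet_in.
by rewrite -(iter_iet_inj hlam zX yX Tz).
Qed.

Definition base_mass a b : R := fine (nu1 `[a, b[).

Lemma base_massE a b : nu1 `[a, b[ = (base_mass a b)%:E.
Proof.
rewrite /base_mass fineK// /nu1 /pushforward measure_fin_num//.
by apply: measurable_fst_preimage; exact: measurable_itv.
Qed.

Lemma base_mass_add : interval_additive base_mass.
Proof.
move=> a b c a0 ab bc c1; apply: EFin_inj; rewrite EFinD -!base_massE.
rewrite -measureU; first last.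
- by apply/seteqP; split=> x //=; rewrite !in_itv/=; lra.
- exact: measurable_itv.
- exact: measurable_itv.
congr (nu1 _); apply/seteqP; split=> x /=; rewrite !in_itv/=.
  by move=> ?; have [?|?] := ltP x b; [left|right]; lra.
by case=> ?; lra.
Qed.

Lemma base_mass_transport k x a b : 0 <= x < 1 ->
  cyl_lo k x <= a -> a <= b -> b <= cyl_hi k x ->
  base_mass (T^(k) x + (a - x)) (T^(k) x + (b - x)) = base_mass a b.
Proof.
move=> xX la ab bh; apply: EFin_inj; rewrite -!base_massE.
rewrite -(mass_iter hlam base_mass_invariant k); last exact: measurable_itv.
congr (nu1 _); apply/seteqP; split=> y /=; rewrite !in_itv/=.
  by move/(image_segment y xX la bh).
by move=> h; apply/(image_segment y xX la bh).
Qed.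

Definition fibre_mass (s : 'Z_N) a b : R :=
  fine (nu (@fst R (cyc N) @^-1` `[a, b[ `&` @snd R (cyc N) @^-1` [set (s : cyc N)])).

Lemma fibre_massE s a b :
  nu (@fst R (cyc N) @^-1` `[a, b[ `&` @snd R (cyc N) @^-1` [set (s : cyc N)]) =
  (fibre_mass s a b)%:E.
Proof.
rewrite /fibre_mass fineK// measure_fin_num//; apply: measurableI.
  by apply: measurable_fst_preimage; exact: measurable_itv.
exact: measurable_snd_preimage.
Qed.

Lemma measurable_fibre (s : 'Z_N) a b :
  measurable (@fst R (cyc N) @^-1` `[a, b[ `&` @snd R (cyc N) @^-1` [set (s : cyc N)]).
Proof.
apply: measurableI; last exact: measurable_snd_preimage.
by apply: measurable_fst_preimage; exact: measurable_itv.
Qed.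

Lemma fibre_mass_ge0 s a b : 0 <= fibre_mass s a b.
Proof. by rewrite fine_ge0. Qed.

Lemma fibre_mass_add s : interval_additive (fibre_mass s).
Proof.
move=> a b c a0 ab bc c1; apply: EFin_inj; rewrite EFinD -!fibre_massE.
rewrite -measureU; first last.
- by apply/seteqP; split=> -[x t] //=; rewrite !in_itv/=; move=> [[? _] [? _]]; lra.
- exact: measurable_fibre.
- exact: measurable_fibre.
congr (nu _); apply/seteqP; split=> -[x t] /=; rewrite !in_itv/=.
  by move=> [? ?]; have [?|?] := ltP x b; [left|right]; split => //; lra.
by case=> -[? ?]; split => //; lra.
Qed.

Lemma fibre_mass_sum a b : \sum_s fibre_mass s a b = base_mass a b.
Proof.
apply: EFin_inj; rewrite -base_massE -sumEFin.
have mB : measurable (@fst R (cyc N) @^-1` `[a, b[).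
  by apply: measurable_fst_preimage; exact: measurable_itv.
rewrite [RHS](measure_finite_partition nu (g := snd) mB); last first.
  by move=> s; exact: measurable_snd_preimage.
by apply: eq_bigr => s _; exact/esym/fibre_massE.
Qed.

Lemma fibre_mass_step s a b : 0 <= a < 1 -> a <= b -> b <= cyl_hi 1 a ->
  (forall x, a <= x < b -> f x = f a) ->
  fibre_mass (s + f a) (T a) (T a + (b - a)) = fibre_mass s a b.
Proof.
move=> aX ab bh const; apply: EFin_inj; rewrite -!fibre_massE.
case: nu_inv => _ inv; rewrite -inv; last exact: measurable_fibre.
have [h0 h1 h2 h3] := cyl_bounds p hlam 1 aX.
have seg x : T a <= T x < T a + (b - a) <-> a <= x < b.
  have := @image_segment 1 a a b x aX h1 bh; rewrite /= subrr addr0; exact.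
congr (nu _); apply/seteqP; split=> -[x t] /=; rewrite /veech_ext /= !in_itv/=.
  move=> [/seg xab]; rewrite const// => e; split => //.
  exact: (addIr _ e).
by move=> [xab ->]; split; [exact/seg|rewrite const].
Qed.

Variable K : nat.
Hypothesis K0 : (0 < K)%N.
Hypothesis hit : forall n x y, 0 <= x < 1 -> 0 <= y < 1 ->
  exists2 k, (k + n <= K * n)%N & agree lam p n y (T^(k) x).
Hypothesis z1X : 0 <= z1 < 1.
Hypothesis z2X : 0 <= z2 < 1.
Hypothesis F_minimal : minimal F.

Let aper := minimal_aperiodic hlam F_minimal.

Lemma unit_leb1 : @unit_leb R `[0, 1[ = 1%E.
Proof. by rewrite unit_lebE ?subr0// ler01. Qed.

Lemma cyl_unit_leb n x : 0 <= x < 1 ->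
  unit_leb `[cyl_lo n x, cyl_hi n x[ = (cyl_len n x)%:E.
Proof. by move=> xX; have [? ? ? ?] := cyl_bounds p hlam n xX; apply: unit_lebE => //; lra. Qed.

Lemma cyl_len_lower n x : 0 <= x < 1 -> (0 < n)%N -> 1 <= cyl_len n x * (K * n)%:R.
Proof.
move=> xX n0; rewrite -lee_fin EFinM -cyl_unit_leb//.
exact: (cyl_mass_lo hlam unit_leb1 (unit_leb_iet p hlam) K0 hit xX n0).
Qed.

Lemma cyl_len_upper n x : 0 <= x < 1 -> cyl_len n x * n%:R <= (2 * K)%:R.
Proof.
move=> xX; rewrite -lee_fin EFinM -cyl_unit_leb//.
exact: (cyl_mass_hi hlam unit_leb1 (unit_leb_iet p hlam) K0 hit aper n xX).
Qed.

Lemma base_mass_length a b : 0 <= a -> a <= b -> b <= 1 -> base_mass a b = b - a.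
Proof.
apply: (mass_eq_length hlam K0 cyl_len_lower cyl_len_upper hit base_mass_add).
- by move=> *; rewrite fine_ge0.
- move=> n x xX; rewrite -lee_fin EFinM -base_massE.
  exact: (cyl_mass_hi hlam base_mass_unit base_mass_invariant K0 hit aper n xX).
- exact: base_mass_transport.
- by apply: EFin_inj; rewrite -base_massE base_mass_unit.
Qed.

Lemma step_jump x y : x < y -> f x <> f y -> x < z1 <= y \/ x < z2 <= y.
Proof.
rewrite /step_fun => xy ne.
have [xz1|z1x] := ltP x z1; have [yz1|z1y] := ltP y z1.
- by move: ne; rewrite xz1 yz1.
- by left.
- by exfalso; lra.
- move: ne; rewrite !ltNge z1x z1y/=.
  have [z2x|xz2] := leP z2 x; have [z2y|yz2] := leP z2 y => //= _.
    by exfalso; lra.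
  by right.
Qed.

Lemma fibre_mass_uniform s a b : 0 <= a -> a <= b -> b <= 1 ->
  fibre_mass s a b = (b - a) / #|{: 'Z_N}|%:R.
Proof.
apply: (equidistributed hlam K0 hit cyl_len_lower cyl_len_upper
  (return_dist hlam K0 hit aper cyl_len_lower) step_jump z1X z2X
  (minimal_dense hlam F_minimal)).
- by move=> *; exact: fibre_mass_ge0.
- exact: fibre_mass_add.
- by move=> *; rewrite fibre_mass_sum base_mass_length.
- exact: fibre_mass_step.
Qed.

(** Each slice is a multiple of Lebesgue measure since it is one on intervals
    ([fibre_mass_uniform]). *)
Lemma invariant_mass_uniform A : measurable A -> nu A = uniform_mass A.
Proof.
move=> mA; rewrite measure_slices// uniform_massE; apply: eq_bigr => s _.
apply: unit_measure_unique; last exact: measurable_slice_preimage.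
- have mX : measurable (@phase_space R N).
    by apply: measurableX => //; exact: measurable_itv.
  have nuC : nu (~` phase_space) = 0%E.
    by rewrite probability_setC//; case: nu_inv => -> _; rewrite subee.
  apply: subset_measure0 nuC; rewrite ?inE.
  + apply: measurableI; last exact: measurable_snd_preimage.
    by apply: measurable_fst_preimage; apply: measurableC; exact: measurable_itv.
  + exact: measurableC.
  + by move=> [x t] /= [nx _] [].
- move=> a b a0 ab b1; apply: (etrans (fibre_massE s a b)).
  by rewrite fibre_mass_uniform// mulrC.
Qed.

End InvariantMasses.

Theorem theorem17 (R : realType) (r : nat) (lam : 'I_r -> R) (p : 'S_r)
    (tau : 'I_r -> R) (N : nat) (z1 z2 : R) (a1 a2 a3 : int)
    (hlam : iet_lengths lam)
    (hT : linearly_recurrent lam p)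
    (hN : (2 <= N)%N)
    (hz : 0 < z1 /\ z1 < z2 /\ z2 < 1)
    (htau : suspension_data p tau)
    (hram : fully_ramified lam p tau N z1 z2 a1 a2 a3)
    (hmin : minimal (veech_ext (N := N) lam p z1 z2 a1 a2 a3)) :
  uniquely_ergodic (veech_ext (N := N) lam p z1 z2 a1 a2 a3).
Proof.
have [K K0 hit] := linearly_recurrent_hit hlam hT.
have [z10 [z12 z21]] := hz.
have z1X : 0 <= z1 < 1 by lra.
have z2X : 0 <= z2 < 1 by lra.
exists (uniform_mass : probability (R * cyc N)%type R).
  split; first exact: uniform_mass1.
  by move=> A mA; exact: uniform_mass_invariant.
move=> nu nu_inv A mA.
exact: (invariant_mass_uniform hlam nu_inv K0 hit z1X z2X hmin mA).
Qed.
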